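(* Let $J:\mathbb{R}_{+}\to\mathbb{R}_{+}$ be continuous with $\int_{\mathbb{Q}_p^n}J(\|x\|_p)\,d^nx=1$, and assume $J(\|x\|_p)$ is of exponential type with exponent $\gamma$ satisfying $-n<\gamma<0$. Let $u(x,t)=\int_{\mathbb{Z}_p^n}\chi_p(-x\cdot\xi)e^{(\widehat{J}(\|\xi\|_p)-1)t}\,d^n\xi$ (the solution of $\partial_tu=J\ast u-u$, $u(x,0)=\Omega(\|x\|_p)$), and let $\mathfrak{J}(t,\omega)$, defined on a probability space $(\Upsilon,\mathcal{F},P)$, be a Markov process on $\mathbb{Q}_p^n$ with transition function $q_t(x,E)=(u(\cdot,t)\ast1_E)(x)$ for $t>0$, $q_0(x,E)=1_E(x)$, and with $P(\mathfrak{J}(0,\omega)\in\mathbb{Z}_p^n)=1$. Let $$\tau_{\mathbb{Z}_p^n}(\omega)=\inf\{t>0:\ \mathfrak{J}(t,\omega)\in\mathbb{Z}_p^n\text{ and there exists }t'\text{ with }0<t'<t\text{ and }\mathfrak{J}(t',\omega)\notin\mathbb{Z}_p^n\}$$ be the first passage time of a path entering $\mathbb{Z}_p^n$. Then $P(\{\omega\in\Upsilon:\tau_{\mathbb{Z}_p^n}(\omega)<\infty\})=1$.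
   Context: $p$ is a prime, $\|x\|_p=\max_i|x_i|_p$ on $\mathbb{Q}_p^n$, $d^nx$ the Haar measure normalized so that $\mathbb{Z}_p^n$ has measure $1$, $\chi_p(y)=\exp(2\pi i\{y\}_p)$ the standard additive character, $\widehat{J}(\|\xi\|_p)=\int\chi_p(\xi\cdot x)J(\|x\|_p)\,d^nx$, $\Omega(\|x\|_p)$ the characteristic function of $\mathbb{Z}_p^n$, $1_E$ the characteristic function of $E$, $\mathcal{B}(\mathbb{Q}_p^n)$ the Borel sets. $J(\|x\|_p)$ is of exponential type if there are positive constants $A,B,C_1$ and real $\gamma>-n$ with $A\|x\|_p^{\gamma}e^{-C_1\|x\|_p}\le J(\|x\|_p)\le B\|x\|_p^{\gamma}e^{-C_1\|x\|_p}$ for all $x$. *)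

(* Defs.v *)
From HB Require Import structures.
From mathcomp Require Import all_boot all_order all_algebra.
From mathcomp Require Import all_classical all_reals all_analysis.
From mathcomp Require Import complex.
Set Implicit Arguments. Unset Strict Implicit. Unset Printing Implicit Defensive.
Import Order.TTheory GRing.Theory Num.Theory.
Import numFieldNormedType.Exports.
Local Open Scope ring_scope.
Local Open Scope classical_set_scope.

(* The field Q_p, represented canonically by the system of residues         *)
(*   a N = (x mod p^N Z_p) in Z[1/p] /\ [0, p^N),   N : int.                *)
Section Padic.
Variable R : realType.
Variable p : nat.

Definition padic_reduce (N : int) (r : rat) : rat :=
  r - (p%:R : rat) ^ N * (Num.floor (r / (p%:R : rat) ^ N))%:~R.

Definition padic_valid (a : int -> rat) : Prop :=
  [/\ forall N, padic_reduce N (a N) = a N,                  (* 0 <= a N < p^N *)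
      forall N, exists k : nat, a N * (p%:R : rat) ^+ k \is a Num.int,
      forall M N, M <= N -> padic_reduce M (a N) = a M
    & exists m, a m = 0].                                 (* x in p^m Z_p *)

Lemma padic_valid0 : padic_valid (fun _ => 0).
Proof.
split.
- by move=> N; rewrite /padic_reduce mul0r floor0 mulr0 subr0.
- by move=> N; exists 0%N; rewrite mul0r; exact: rpred0.
- by move=> M N _; rewrite /padic_reduce mul0r floor0 mulr0 subr0.
- by exists 0.
Qed.

Definition Qp : Type := {a : int -> rat | padic_valid a}.
HB.instance Definition _ := gen_eqMixin Qp.
HB.instance Definition _ := gen_choiceMixin Qp.

Definition Qp0 : Qp := exist _ (fun _ => 0) padic_valid0.
HB.instance Definition _ := isPointed.Build Qp Qp0.

Definition padic_res (x : Qp) : int -> rat := proj1_sig x.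

Definition mkQp (a : int -> rat) : Qp :=
  match pselect (padic_valid a) with
  | left h => exist _ a h
  | right _ => Qp0
  end.

Definition addQp (x y : Qp) : Qp :=
  mkQp (fun N => padic_reduce N (padic_res x N + padic_res y N)).
Definition oppQp (x : Qp) : Qp :=
  mkQp (fun N => padic_reduce N (- padic_res x N)).
(* (x y) mod p^N = (x_M y_M) mod p^N for all M large enough *)
Definition mulQp (x y : Qp) : Qp :=
  mkQp (fun N => xget 0 (fun r : rat => exists M0 : int, forall M, M0 <= M ->
          padic_reduce N (padic_res x M * padic_res y M) = r)).

(* p-adic fractional part {x}_p = x mod Z_p in [0,1) *)
Definition fracQp (x : Qp) : rat := padic_res x 0.

Definition normQp (x : Qp) : R :=
  inf [set (p%:R : R) ^ (- m) | m in [set m : int | padic_res x m = 0]].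

Definition chi_p (y : Qp) : R[i] :=
  let th := 2 * pi * ratr (fracQp y) in (cos th +i* sin th)%C.

Variable n : nat.

Definition Qpn : Type := 'I_n -> Qp.

Definition addQpn (x y : Qpn) : Qpn := fun i => addQp (x i) (y i).
Definition oppQpn (x : Qpn) : Qpn := fun i => oppQp (x i).
Definition dotQpn (x y : Qpn) : Qp := \big[addQp/Qp0]_(i < n) mulQp (x i) (y i).
Definition normQpn (x : Qpn) : R := \big[Num.max/0]_(i < n) normQp (x i).

Definition Zpn : set Qpn := [set x | normQpn x <= 1].

Definition padic_open : set (set Qpn) :=
  [set U | forall x, U x ->
     exists r : R, 0 < r /\ [set y | normQpn (addQpn y (oppQpn x)) < r] `<=` U].

Definition QpnB : Type := g_sigma_algebraType padic_open.

End Padic.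

Definition cexp (R : realType) (z : R[i]) : R[i] :=
  ((expR (complex.Re z))%:C * (cos (complex.Im z) +i* sin (complex.Im z)))%C.

Definition cintegral d (T : measurableType d) (R : realType)
  (mu : measure T R) (D : set T) (f : T -> R[i]) : R[i] :=
  (Rintegral mu D (fun x => complex.Re (f x))
     +i* Rintegral mu D (fun x => complex.Im (f x)))%C.

Arguments Zpn R p n _ : clear implicits.
Section Model.
Variables (R : realType) (p n : nat).
Variable mu : measure (QpnB R p n) R.   (* Haar measure on Q_p^n *)
Variable J : R -> R.
Local Notation Qpn := (QpnB R p n).

Definition Jhat (xi : Qpn) : R[i] :=
  cintegral mu setT (fun x : Qpn =>
    (chi_p R (dotQpn xi x) * (J (normQpn R x))%:C)%C).

Definition u_sol (x : Qpn) (t : R) : R[i] :=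
  cintegral mu (Zpn R p n) (fun xi : Qpn =>
    (chi_p R (oppQp (dotQpn x xi)) * cexp ((Jhat xi - 1) * t%:C))%C).

Definition q_trans (t : R) (x : Qpn) (E : set Qpn) : R[i] :=
  if 0 < t then
    cintegral mu setT (fun y : Qpn =>
      (u_sol (addQpn x (oppQpn y)) t * (\1_E y : R)%:C)%C)
  else ((\1_E x : R)%:C)%C.

End Model.

Definition nat_filtration d (Omega : measurableType d) d' (T : measurableType d')
  (R : realType) (X : R -> Omega -> T) (s : R) : set (set Omega) :=
  <<s [set A | exists r : R, (0 <= r <= s) /\
                 exists B : set T, measurable B /\ A = X r @^-1` B] >>.

Definition is_markov_process d (Omega : measurableType d) d'
  (T : measurableType d') (R : realType) (P : probability Omega R)
  (X : R -> Omega -> T) (q : R -> T -> set T -> R[i]) : Prop :=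
  (forall t, 0 <= t -> measurable_fun setT (X t)) /\
  (forall s t, 0 <= s -> s <= t -> forall E : set T, measurable E ->
    forall A, nat_filtration X s A ->
      ((fine (P (A `&` X t @^-1` E)))%:C)%C =
      cintegral P A (fun w => q (t - s) (X s w) E)).

Definition first_passage_time (Omega : Type) (T : Type) (R : realType)
  (X : R -> Omega -> T) (Z : set T) (w : Omega) : \bar R :=
  ereal_inf [set t%:E | t in [set t : R | 0 < t /\ Z (X t w) /\
              exists t', (0 < t' < t) /\ ~ Z (X t' w)]].

(* Main.v *)
Require Import Defs.
From HB Require Import structures.
From mathcomp Require Import all_boot all_order all_algebra.
From mathcomp Require Import all_classical all_reals all_analysis.
From mathcomp Require Import measurable_realfun.
From mathcomp Require Import complex.
From mathcomp Require Import zify ring lra.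
Import Order.TTheory GRing.Theory Num.Theory.
Import numFieldNormedType.Exports.
Local Open Scope ring_scope.
Local Open Scope classical_set_scope.
Set Implicit Arguments.
Unset Strict Implicit.
Unset Printing Implicit Defensive.

(* The process is observed at integer times. Since characters are trivial on
   Z_p^n x Z_p^n, q_t(x, Z_p^n) is the same number r(t) for all x in Z_p^n,
   namely the integral over Z_p^n of exp (- t a(xi)) with a = 1 - Jhat; a is
   real because Haar measure is invariant under x |-> - x. Hence the visits to
   Z_p^n at integer times form a renewal sequence with weights r(m), and they
   recur almost surely as soon as the sum of the r(m) diverges.
   For |xi| <= p^-k one has a(xi) <= 2 int_{|x| > p^k} J. The exponential decay
   of J makes this O(p^(-k(n+1))), while the ball |xi| <= p^-k has measure at
   least p^(-kn), so about p^(k(n+1)) terms of the series are at least of order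
   p^(-kn). Finally r(1) < 1, because a is bounded below near e_1 by the mass J
   puts near p^-1 e_1; so the process leaves Z_p^n almost surely. *)

(** * Residues of p-adic numbers *)

(** The passage time is an infimum over uncountably many times, and no regularity of the paths is
    assumed. A positive integer time spent outside Z_p^n followed by a later integer time inside
    bounds it from above, so the exceptional paths are covered by countably many null events. The
    value of J at 0 is unconstrained, since every bound on J concerns positive radii. The origin is
    therefore set apart throughout: local constancy is asked only away from it, and the factor 1 -
    cos of the symbol, which vanishes there, removes J(0) from all questions of sign. Where the
    exponent n+1 comes from: the ball |xi| <= p^-k costs a factor p^(-kn), so a tail of order
    p^(-ks) leads to partial sums of order p^(k(s-n)). Any s > n makes them unbounded, and n+1 is
    the first integer one. The analysis on Q_p^n is carried by residues: balls are sets with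
    prescribed residues, and norms, phases and measures are computed by congruences between
    rationals. *)

Section Residues.
Variables (p : nat) (hp : prime p).
Implicit Types (r s : rat) (N M : int) (x y : Qp p).
Local Notation pr := (p%:R : rat).

(** Congruence modulo p^N Z instead of p^N Z_p: residues lie in Z[1/p], where the two notions agree,
    so everything becomes rational arithmetic. *)
Definition cong N r s := exists z : int, r - s = pr ^ N * z%:~R.

Lemma p_neq0 : pr != 0.
Proof. by rewrite pnatr_eq0 -lt0n prime_gt0. Qed.

Lemma pexp_neq0 N : pr ^ N != 0.
Proof. exact: expfz_neq0 p_neq0. Qed.

Lemma pexp_int N : 0 <= N -> exists z : int, pr ^ N = z%:~R.
Proof. by case: N => // k _; exists (p%:Z ^+ k); rewrite rmorphXn /= -exprnP. Qed.

Lemma cong_refl N r : cong N r r.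
Proof. by exists 0; rewrite subrr mulr0. Qed.

Lemma cong_sym {N r s} : cong N r s -> cong N s r.
Proof. by move=> [z h]; exists (- z); rewrite rmorphN /= mulrN -h opprB. Qed.

Lemma cong_trans {N r s t} : cong N r s -> cong N s t -> cong N r t.
Proof.
move=> [z h] [w k]; exists (z + w).
by rewrite rmorphD /= mulrDr -h -k addrA subrK.
Qed.

Lemma cong_add {N r r' s s'} : cong N r r' -> cong N s s' -> cong N (r + s) (r' + s').
Proof.
move=> [z h] [w k]; exists (z + w).
by rewrite rmorphD /= mulrDr -h -k; ring.
Qed.

Lemma cong_opp {N r s} : cong N r s -> cong N (- r) (- s).
Proof. by move=> [z h]; exists (- z); rewrite rmorphN /= mulrN -h; ring. Qed.

Lemma cong_le {M N r s} : M <= N -> cong N r s -> cong M r s.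
Proof.
move=> MN [z h].
have [|w hw] := @pexp_int (N - M); first by rewrite subr_ge0.
exists (w * z); rewrite h rmorphM /= mulrA -hw -expfzDr ?p_neq0 //.
by rewrite addrC subrK.
Qed.

Lemma cong_mulr {M N r s t} : cong M r s -> cong N t 0 -> cong (M + N) (r * t) (s * t).
Proof.
move=> [z h] [w k]; exists (z * w).
rewrite subr0 in k.
by rewrite -mulrBl h k expfzDr ?p_neq0 // rmorphM /=; ring.
Qed.

Lemma reduce_cong N r : cong N (padic_reduce p N r) r.
Proof.
exists (- Num.floor (r / pr ^ N)); rewrite /padic_reduce rmorphN /=; ring.
Qed.

Lemma reduce_eq {N r s} : cong N r s -> padic_reduce p N r = padic_reduce p N s.
Proof.
move=> [z h]; have -> : r = s + pr ^ N * z%:~R by rewrite -h; ring.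
rewrite /padic_reduce mulrDl [_ * z%:~R]mulrC mulfK ?pexp_neq0 //.
by rewrite floorDrz ?intr_int // intrKfloor intrD; ring.
Qed.

Lemma reduceP N r s : padic_reduce p N r = padic_reduce p N s <-> cong N r s.
Proof.
split=> [e|]; last exact: reduce_eq.
by apply: cong_trans (cong_sym (reduce_cong N r)) _; rewrite e; exact: reduce_cong.
Qed.

Lemma reduce_id N r : padic_reduce p N (padic_reduce p N r) = padic_reduce p N r.
Proof. exact/reduceP/reduce_cong. Qed.

Lemma reduce0 N : padic_reduce p N 0 = 0.
Proof. by rewrite /padic_reduce mul0r floor0 mulr0 subr0. Qed.

Lemma reduce_le M N r : M <= N ->
  padic_reduce p M (padic_reduce p N r) = padic_reduce p M r.
Proof. by move=> MN; apply/reduceP/(cong_le MN)/reduce_cong. Qed.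

Definition pint r := exists k : nat, r * pr ^+ k \is a Num.int.

Lemma cong_pint N r s : cong N r s -> pint s -> pint r.
Proof.
move=> [z h] [k hk]; exists (k + `|N|)%N.
have -> : r = s + pr ^ N * z%:~R by rewrite -h; ring.
have [|w hw] := @pexp_int (`|N|%N%:Z + N).
  by case: (N) => m //; rewrite NegzE /= addrN.
have -> : (s + pr ^ N * z%:~R) * pr ^+ (k + `|N|) =
          (s * pr ^+ k) * pr ^+ `|N|%N + (pr ^+ `|N|%N * pr ^ N) * pr ^+ k * z%:~R.
  by rewrite exprD; ring.
rewrite [pr ^+ `|N|%N * _](_ : _ = w%:~R); last by rewrite -hw expfzDr ?p_neq0.
apply: rpredD; first by apply: rpredM => //; rewrite rpredX // natr_int.
by apply: rpredM; rewrite ?intr_int // rpredM // ?intr_int // rpredX // natr_int.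
Qed.

Lemma cong0_pint N r : cong N r 0 -> pint r.
Proof. by move/cong_pint; apply; exists 0%N; rewrite mul0r rpred0. Qed.

(** Common way to build p-adic numbers from unreduced representatives. Membership in Z[1/p] follows
    by descending to the level min(m, N), where [b] is congruent to 0. *)
Lemma padic_valid_reduce (b : int -> rat) (m : int) :
    (forall M N, M <= N -> cong M (b N) (b M)) -> cong m (b m) 0 ->
  padic_valid p (fun N => padic_reduce p N (b N)).
Proof.
move=> hb hm; split.
- by move=> N; rewrite reduce_id.
- move=> N; have hN : cong N (padic_reduce p N (b N)) (b N) by exact: reduce_cong.
  apply: cong_pint hN _; apply: (@cong0_pint (Num.min m N)).
  apply: (@cong_trans _ _ (b (Num.min m N))).
    by apply: hb; rewrite ge_min lexx orbT.
  apply: (@cong_trans _ _ (b m)).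
    by apply/cong_sym/hb; rewrite ge_min lexx.
  by apply: cong_le hm; rewrite ge_min lexx.
- by move=> M N MN; rewrite reduce_le //; exact/reduceP/hb.
- by exists m; rewrite (reduce_eq hm) reduce0.
Qed.

Lemma res_mkQp a : padic_valid p a -> padic_res (mkQp p a) = a.
Proof. by move=> h; rewrite /mkQp; case: pselect. Qed.

Lemma res_valid x : padic_valid p (padic_res x).
Proof. exact: proj2_sig. Qed.

Lemma res_inj x y : padic_res x =1 padic_res y -> x = y.
Proof.
case: x => a ha; case: y => b hb /= /funext e; subst b.
by congr exist; exact: Prop_irrelevance.
Qed.

Lemma res_cong x {M N} : M <= N -> cong M (padic_res x N) (padic_res x M).
Proof.
have [h1 _ h3 _] := res_valid x.
by move=> MN; apply/reduceP; rewrite (h3 _ _ MN) h1.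
Qed.

Lemma res_reduce x N : padic_reduce p N (padic_res x N) = padic_res x N.
Proof. by have [->] := res_valid x. Qed.

Lemma res_eqP x y N : padic_res x N = padic_res y N <->
  cong N (padic_res x N) (padic_res y N).
Proof. by rewrite -reduceP !res_reduce. Qed.

Lemma res0 N : padic_res (Qp0 p) N = 0. Proof. by []. Qed.

Lemma res_add x y N :
  padic_res (addQp x y) N = padic_reduce p N (padic_res x N + padic_res y N).
Proof.
have [_ _ _ [m hm]] := res_valid x; have [_ _ _ [m' hm']] := res_valid y.
rewrite /addQp res_mkQp //; apply: (@padic_valid_reduce _ (Num.min m m')).
  by move=> M K MK; apply: cong_add; exact: res_cong.
rewrite -[0]addr0; apply: cong_add.
  apply: (@cong_trans _ _ (padic_res x m)); last by rewrite hm; exact: cong_refl.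
  by apply/cong_sym/res_cong; rewrite ge_min lexx.
apply: (@cong_trans _ _ (padic_res y m')); last by rewrite hm'; exact: cong_refl.
by apply/cong_sym/res_cong; rewrite ge_min lexx orbT.
Qed.

Lemma res_opp x N : padic_res (oppQp x) N = padic_reduce p N (- padic_res x N).
Proof.
have [_ _ _ [m hm]] := res_valid x.
rewrite /oppQp res_mkQp //; apply: (@padic_valid_reduce _ m).
  by move=> M K MK; apply: cong_opp; exact: res_cong.
by rewrite hm oppr0; exact: cong_refl.
Qed.

(** The embedding of Z[1/p] into Q_p; for any other rational the residues are not valid and [mkQp]
    falls back to [Qp0]. *)
Definition ratQp r : Qp p := mkQp p (fun N => padic_reduce p N r).

Lemma res_ratQp r m N : cong m r 0 -> padic_res (ratQp r) N = padic_reduce p N r.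
Proof.
move=> h; rewrite /ratQp res_mkQp //; apply: (@padic_valid_reduce _ m) => // *.
exact: cong_refl.
Qed.

Lemma res_mono x M N : M <= N -> padic_res x N = 0 -> padic_res x M = 0.
Proof.
move=> MN h; apply/(res_eqP x (Qp0 p) M).
by apply: cong_trans (cong_sym (res_cong x MN)) _; rewrite h; exact: cong_refl.
Qed.

Lemma res_bounded x : exists k : nat, padic_res x (- k%:Z) = 0.
Proof.
have [_ _ _ [m hm]] := res_valid x.
exists `|m|%N; apply: res_mono hm; rewrite lerNl.
by rewrite (le_trans (ler_norm _)) // normrN abszE.
Qed.

Lemma res_cong0 x m M : m <= M -> padic_res x m = 0 -> cong m (padic_res x M) 0.
Proof. by move=> mM h; rewrite -h; exact: res_cong. Qed.

(** Each factor lies in p^(-m) Z_p, so an error in p^M Z_p in the other factor becomes one in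
    p^(M-m) Z_p in the product. *)
Lemma mul_cong x y (m : nat) (M M' : int) :
    padic_res x (- m%:Z) = 0 -> padic_res y (- m%:Z) = 0 -> 
    m%:Z <= M -> M <= M' ->
  cong (M - m%:Z) (padic_res x M' * padic_res y M') (padic_res x M * padic_res y M).
Proof.
move=> hx hy mM MM'.
have mM' : - m%:Z <= M by rewrite (le_trans _ mM) // ge0_cp.
apply: (@cong_trans _ _ (padic_res x M * padic_res y M')).
  apply: cong_mulr; first exact: res_cong.
  by apply: res_cong0 => //; exact: le_trans MM'.
rewrite ![padic_res x M * _]mulrC; apply: cong_mulr; first exact: res_cong.
exact: res_cong0.
Qed.

Lemma res_mul x y (m : nat) (N M : int) :
    padic_res x (- m%:Z) = 0 -> padic_res y (- m%:Z) = 0 -> 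
    m%:Z <= M -> N + m%:Z <= M ->
  padic_res (mulQp x y) N = padic_reduce p N (padic_res x M * padic_res y M).
Proof.
move=> hx hy.
(* Truncations precise enough, by [mul_cong], to fix the product modulo p^K. *)
pose b K := let L := Num.max m%:Z (K + m%:Z) in padic_res x L * padic_res y L.
have bE K L : m%:Z <= L -> K + m%:Z <= L ->
    cong K (padic_res x L * padic_res y L) (b K).
  move=> h1 h2; have := @mul_cong x y m (Num.max m%:Z (K + m%:Z)) L hx hy.
  rewrite le_max lexx ge_max h1 h2 => /(_ isT isT); apply: cong_le.
  by rewrite lerBrDr le_max lexx orbT.
have -> : mulQp x y = mkQp p (fun K => padic_reduce p K (b K)).
  rewrite /mulQp; congr mkQp; apply/funext => K; apply: xget_unique.
    exists (Num.max m%:Z (K + m%:Z)) => L; rewrite ge_max => /andP[h1 h2].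
    exact/reduceP/bE.
  move=> r [L0 /(_ (Num.max L0 (Num.max m%:Z (K + m%:Z)))) <-].
    by apply/reduceP/bE; rewrite !le_max lexx ?orbT.
  by rewrite le_max lexx.
move=> h1 h2; rewrite res_mkQp; first exact/esym/reduceP/bE.
(* The product lies in p^(-2m) Z_p, so -2m is a level at which it vanishes. *)
apply: (@padic_valid_reduce _ (- m%:Z - m%:Z)) => [K L KL|].
  apply: bE; first by rewrite le_max lexx.
  by rewrite le_max lerD2r KL orbT.
rewrite /b addrNK; set L := Num.max _ _.
have hL : - m%:Z <= L by rewrite le_max lexx orbT.
rewrite -(mul0r (padic_res y L)); apply: cong_mulr; exact: res_cong0.
Qed.

End Residues.

(** * Cylinders, norm and Borel sets *)

Section Cylinders.
Variables (R : realType) (p : nat) (hp : prime p) (n : nat).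
Implicit Types (N M : int) (x y : Qpn p n).
Local Notation pR := (p%:R : R).

Definition zeroQpn : Qpn p n := fun=> Qp0 p.

(** The ball x + (p^N Z_p)^n of radius p^(-N), described by residues so that congruences can replace
    the norm. *)
Definition cyl N x : set (Qpn p n) :=
  [set y | forall i, padic_res (y i) N = padic_res (x i) N].

Lemma cyl_sym {N x y} : cyl N x y -> cyl N y x.
Proof. by move=> h i; rewrite h. Qed.

Lemma cyl_trans {N x y z} : cyl N x y -> cyl N y z -> cyl N x z.
Proof. by move=> h1 h2 i; rewrite h2 h1. Qed.

Lemma cyl_le {M N x y} : M <= N -> cyl N x y -> cyl M x y.
Proof.
move=> MN h i; apply/(res_eqP hp).
apply: cong_trans (cong_sym (res_cong hp (y i) MN)) _; rewrite h.
exact: (res_cong hp (x i) MN).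
Qed.

Lemma cyl_bounded x : exists k : nat, cyl (- k%:Z) zeroQpn x.
Proof.
have /cid[f hf] : exists f : 'I_n -> nat, forall i, padic_res (x i) (- (f i)%:Z) = 0.
  apply: (@fin_all_exists _ _ (fun i k => padic_res (x i) (- k%:Z) = 0)) => i.
  exact: res_bounded.
exists (\max_i f i)%N => i; apply: res_mono (hf i) => //.
by rewrite lerN2 lez_nat leq_bigmax.
Qed.

Lemma cyl_sub N x y : cyl N zeroQpn (addQpn y (oppQpn x)) <-> cyl N x y.
Proof.
suff h i : padic_res (addQpn y (oppQpn x) i) N = 0 <->
    padic_res (y i) N = padic_res (x i) N by split => hh i; apply/h.
rewrite /addQpn /oppQpn (res_add hp) (res_opp hp) -{1}(reduce0 p N).
rewrite (reduceP hp) (res_eqP hp); split => h.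
  have := cong_add h (cong_refl p N (padic_res (x i) N)); rewrite add0r.
  apply: cong_trans; rewrite -{1}[padic_res (y i) N]addr0 -addrA.
  apply: cong_add (cong_refl _ _ _) _; rewrite -{1}(addNr (padic_res (x i) N)).
  exact: cong_add (cong_sym (reduce_cong _ _ _)) (cong_refl _ _ _).
rewrite -(subrr (padic_res (x i) N)).
exact: cong_add h (reduce_cong _ _ _).
Qed.

(** Puts a ball in the form of a translate, the form in which invariance of the measure is
    stated. *)
Lemma cyl_add N x : cyl N x = [set addQpn x y | y in cyl N zeroQpn].
Proof.
apply/seteqP; split => [y xy|_ [y h <-] i]; last first.
  by rewrite /addQpn (res_add hp) h res0 addr0 (res_reduce).
exists (addQpn y (oppQpn x)); first exact/cyl_sub.
apply/funext => i; apply: res_inj => K.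
rewrite -[RHS]res_reduce [LHS](res_add hp (x i)) (res_add hp (y i)) (res_opp hp (x i)).
apply/(reduceP hp).
rewrite {2}(_ : padic_res (y i) K = padic_res (x i) K +
    (padic_res (y i) K + - padic_res (x i) K)); last by rewrite addrC subrK.
apply: cong_add; first exact: cong_refl.
apply: cong_trans (reduce_cong _ _ _) _.
exact: cong_add (cong_refl _ _ _) (reduce_cong _ _ _).
Qed.

Lemma pR_gt1 : 1 < pR. Proof. by rewrite ltr1n prime_gt1. Qed.
Lemma pR_gt0 : 0 < pR. Proof. exact: lt_trans pR_gt1. Qed.

(** If the residue at N is nonzero, only levels below N enter the infimum, which is then at least
    p^(1-N): the norm takes no value strictly between p^(-N) and p^(1-N). *)
Lemma normQp_le_res (x : Qp p) N : normQp R x <= pR ^ (- N) <-> padic_res x N = 0.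
Proof.
have lb : has_lbound [set pR ^ (- m) | m in [set m : int | padic_res x m = 0]].
  by exists 0 => _ [m _ <-]; rewrite exprz_ge0 // ltW // pR_gt0.
split=> [h|h]; last first.
  by apply: ge_inf => //; exists N.
apply: contrapT => hN.
have : pR ^ (1 - N) <= normQp R x.
  apply: lb_le_inf.
    by have [_ _ _ [m hm]] := res_valid x; exists (pR ^ (- m)); exists m.
  move=> _ [m /= hm <-]; rewrite ler_weXz2l ?(ltW pR_gt1) //.
  have : m < N by rewrite ltNge; apply/negP => Nm; apply: hN; exact: res_mono hm.
  by lia.
move=> /le_trans /(_ h); rewrite ler_eXz2l ?pR_gt1 //; lia.
Qed.

Lemma normQp_gt_res (x : Qp p) N : padic_res x N != 0 -> pR ^ (1 - N) <= normQp R x.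
Proof.
move=> h; apply: lb_le_inf.
  by have [_ _ _ [m hm]] := res_valid x; exists (pR ^ (- m)); exists m.
move=> _ [m /= hm <-]; rewrite ler_weXz2l ?(ltW pR_gt1) //.
have : m < N by rewrite ltNge; apply: contra h => Nm; apply/eqP; exact: res_mono hm.
by lia.
Qed.

Lemma pRz_gt0 N : 0 < pR ^ N. Proof. by rewrite exprz_gt0 // pR_gt0. Qed.

Lemma normQpn_le x N : normQpn R x <= pR ^ (- N) <-> cyl N zeroQpn x.
Proof.
split=> [/bigmax_leP[_ h] i|h]; first exact/normQp_le_res/h.
by apply/bigmax_leP; split=> [|i _]; [exact/ltW/pRz_gt0|exact/normQp_le_res/h].
Qed.

Lemma normQpn_ge x N : ~ cyl N zeroQpn x -> pR ^ (1 - N) <= normQpn R x.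
Proof.
move=> /existsNP[i /eqP hi]; apply: le_trans (normQp_gt_res hi) _.
exact: (le_bigmax _ (fun i => normQp R (x i))).
Qed.

Lemma normQpn_ge0 x : 0 <= normQpn R x.
Proof. by apply/bigmax_geP; left. Qed.

Lemma Zpn_cyl : Zpn R p n = cyl 0 zeroQpn.
Proof.
by apply/seteqP; split=> x; have := normQpn_le x 0; rewrite oppr0 expr0z => -[].
Qed.

Lemma neq_cyl x : x <> zeroQpn -> exists N, ~ cyl N zeroQpn x.
Proof.
move=> x0; apply: contrapT => /forallNP h; apply: x0.
apply/funext => i; apply: res_inj => N.
by have /contrapT/(_ i) := h N.
Qed.

Lemma normQpn_gt0 x : x <> zeroQpn -> 0 < normQpn R x.
Proof.
by move=> /neq_cyl[N /normQpn_ge]; apply: lt_le_trans; exact: pRz_gt0.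
Qed.

(** The levels at which a residue vanishes all lie below N, and there the residues are reductions of
    the one at N. *)
Lemma normQp_eq (x y : Qp p) N : padic_res x N = padic_res y N ->
  padic_res x N != 0 -> normQp R x = normQp R y.
Proof.
move=> xy x0; have sub (u v : Qp p) m : padic_res u N = padic_res v N ->
    padic_res u N != 0 -> padic_res u m = 0 -> padic_res v m = 0.
  move=> uv u0 um; have mN : m <= N.
    rewrite leNgt; apply: contra u0 => Nm; apply/eqP.
    exact: (res_mono hp (ltW Nm)).
  rewrite -um; apply/(res_eqP hp).
  apply: cong_trans (cong_sym (res_cong hp v mN)) _.
  by rewrite -uv; exact: res_cong.
congr inf; apply/seteqP; split=> _ [m hm <-]; exists m => //.
  exact: (sub x).
by apply: (sub y) => //; rewrite -xy.
Qed.

Lemma normQpn_cyl N x y : ~ cyl N zeroQpn x -> cyl N x y -> normQpn R y = normQpn R x.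
Proof.
suff h u v : ~ cyl N zeroQpn u -> cyl N u v -> normQpn R v <= normQpn R u.
  move=> x0 xy; apply/le_anti/andP; split; first exact: h.
  apply: h; last exact: cyl_sym.
  by move=> y0; apply: x0; exact: cyl_trans y0 (cyl_sym xy).
move=> u0 uv; apply/bigmax_leP; split=> [|i _]; first exact: normQpn_ge0.
(* A coordinate vanishing modulo p^N has norm at most p^(-N), below the norm of [u], which is at
   least p^(1-N). *)
have [vi0|vi0] := eqVneq (padic_res (v i) N) 0.
  apply: le_trans (normQpn_ge u0); apply: le_trans (_ : pR ^ (- N) <= _).
    exact/normQp_le_res.
  by rewrite ler_weXz2l ?(ltW pR_gt1) //; lia.
rewrite (normQp_eq (uv i) vi0).
exact: (le_bigmax _ (fun i => normQp R (u i))).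
Qed.

Lemma padic_openP (U : set (Qpn p n)) :
  @padic_open R p n U <-> forall x, U x -> exists N, cyl N x `<=` U.
Proof.
split=> h x Ux; have [] := h x Ux.
  move=> r [r0 hr].
  have /cvgrPdist_lt/(_ r r0)[k _ /(_ k)/= hk] : pR^-1 ^+ i @[i --> \oo] --> 0.
    by apply: cvg_expr; rewrite ger0_norm ?invf_lt1 ?pR_gt0 ?pR_gt1 // invr_ge0 ltW ?pR_gt0.
  exists k%:Z => y /cyl_sub /normQpn_le hy; apply: hr => /=; apply: le_lt_trans hy _.
  have := hk (leqnn k); rewrite sub0r normrN gtr0_norm ?exprn_gt0 ?invr_gt0 ?pR_gt0 //.
  by rewrite exprVn -exprnN.
move=> N hN; exists (pR ^ (1 - N)); split; first exact: pRz_gt0.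
move=> y /= hy; apply: hN; apply/cyl_sub; apply: contrapT => /normQpn_ge.
by rewrite leNgt hy.
Qed.

Lemma measurable_cyl N x : measurable (cyl N x : set (QpnB R p n)).
Proof.
apply: sub_sigma_algebra; apply/padic_openP => y xy; exists N => z yz.
exact: cyl_trans yz.
Qed.

Lemma measurable_Zpn : measurable (Zpn R p n : set (QpnB R p n)).
Proof. by rewrite Zpn_cyl; exact: measurable_cyl. Qed.

Lemma measurable_zeroQpn : measurable ([set zeroQpn] : set (QpnB R p n)).
Proof.
rewrite (_ : [set zeroQpn] = \bigcap_(k : nat) (cyl k%:Z zeroQpn : set (QpnB R p n))).
  by apply: bigcapT_measurable => k; exact: measurable_cyl.
apply/seteqP; split=> [x -> k _ //|x hx /=]; apply: contrapT => /neq_cyl[N]; apply.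
by apply: (@cyl_le _ `|N|%N) (hx _ I); rewrite abszE ler_norm.
Qed.

(** A superlevel set deprived of the origin is open, and the origin is a Borel point that can be put
    back. *)
Lemma measurable_cyl_cont (f : QpnB R p n -> R) :
    (forall x, x <> zeroQpn -> forall e, 0 < e ->
      exists N, forall y, cyl N x y -> `|f y - f x| < e) ->
  measurable_fun setT f.
Proof.
move=> hf; apply: (measurability _ (@RGenOInfty.measurableE R)) => _ [_ [a ->] <-].
rewrite setTI; set U := f @^-1` _.
have UE y : U y = (a < f y) by rewrite /U /preimage /= in_itv /= andbT.
have oU : measurable (U `\ zeroQpn : set (QpnB R p n)).
  apply: sub_sigma_algebra; apply/padic_openP => x []; rewrite UE => ax x0.
  have [|N hN] := hf x x0 (f x - a); first by rewrite subr_gt0.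
  have [M hM] := neq_cyl x0.
  exists (Num.max N M) => y xy; split.
    rewrite UE.
    have /hN : cyl N x y by apply: cyl_le xy; rewrite le_max lexx.
    by rewrite ltr_norml => /andP[]; rewrite opprB ltrBDr subrK.
  move=> /= y0; apply: hM; rewrite -y0; apply: cyl_sym; apply: cyl_le xy.
  by rewrite le_max lexx orbT.
have [U0|U0] := pselect (U zeroQpn); last by rewrite not_setD1 in oU.
rewrite -(setD1K U0); apply: measurableU => //; exact: measurable_zeroQpn.
Qed.

End Cylinders.
Arguments zeroQpn p n _ : clear implicits.

(** * The phase of the characters *)

Section Dot.
Variables (R : realType) (p : nat) (hp : prime p) (n : nat).
Implicit Types (N M : int) (x y xi : Qpn p n).
Local Notation pr := (p%:R : rat).

Lemma res_sum (F : 'I_n -> Qp p) (r : 'I_n -> rat) N :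
    (forall i, cong p N (padic_res (F i) N) (r i)) ->
  cong p N (padic_res (\big[@addQp p/Qp0 p]_(i < n) F i) N) (\sum_(i < n) r i).
Proof.
move=> h; elim/big_ind2: _ => //; first exact: cong_refl.
move=> r1 x r2 y h1 h2; rewrite (res_add hp x y).
exact: cong_trans (reduce_cong _ _ _) (cong_add h1 h2).
Qed.

Definition phase x y : rat := fracQp (dotQpn x y).

(** By [mul_cong] the truncation at a level M >= m changes the products by elements of p^(M-m) Z_p,
    which the phase does not see. *)
Lemma phaseE x y (m : nat) M :
    cyl (- m%:Z) (zeroQpn p n) x -> cyl (- m%:Z) (zeroQpn p n) y -> m%:Z <= M ->
  phase x y = padic_reduce p 0 (\sum_(i < n) padic_res (x i) M * padic_res (y i) M).
Proof.
move=> hx hy mM; rewrite /phase /fracQp -res_reduce; apply/(reduceP hp).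
apply: res_sum => i; rewrite (res_mul hp (hx i) (hy i) mM) ?add0r //.
exact: reduce_cong.
Qed.

Lemma phase_eq (m : nat) xi xi' x x' :
    cyl (- m%:Z) (zeroQpn p n) xi -> cyl (- m%:Z) (zeroQpn p n) x ->
    cyl m%:Z xi xi' -> cyl m%:Z x x' ->
  phase xi' x' = phase xi x.
Proof.
move=> hxi hx hxi' hx'.
have mm : - m%:Z <= m%:Z by lia.
rewrite (phaseE hxi hx (lexx _)) (@phaseE xi' x' m m%:Z) //.
- by under eq_bigr => i _ do rewrite hxi' hx'.
- exact: cyl_trans hxi (cyl_le hp mm hxi').
- exact: cyl_trans hx (cyl_le hp mm hx').
Qed.

Lemma phase_eq0 (m : nat) xi x :
  cyl m%:Z (zeroQpn p n) xi -> cyl (- m%:Z) (zeroQpn p n) x -> phase xi x = 0.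
Proof.
move=> hxi hx; have mm : - m%:Z <= m%:Z by lia.
rewrite (phaseE (cyl_le hp mm hxi) hx (lexx _)) big1 ?reduce0 // => i _.
by rewrite hxi res0 mul0r.
Qed.

(** Only a congruence modulo 1: phases are taken in [0,1), so the phase of -x is 1 minus that of x
    unless both vanish. *)
Lemma phase_opp xi x : cong p 0 (phase xi (oppQpn x)) (- phase xi x).
Proof.
have [m1 h1] := cyl_bounded hp xi; have [m2 h2] := cyl_bounded hp x.
pose m := maxn m1 m2.
have hxi : cyl (- m%:Z) (zeroQpn p n) xi.
  by apply: cyl_le h1 => //; rewrite lerN2 lez_nat leq_maxl.
have hx : cyl (- m%:Z) (zeroQpn p n) x.
  by apply: cyl_le h2 => //; rewrite lerN2 lez_nat leq_maxr.
have hx' : cyl (- m%:Z) (zeroQpn p n) (oppQpn x).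
  by move=> i; rewrite /oppQpn (res_opp hp) hx res0 oppr0 reduce0.
rewrite (phaseE hxi hx (lexx _)) (phaseE hxi hx' (lexx _)).
apply: cong_trans (reduce_cong _ _ _) _.
apply: cong_trans _ (cong_opp (cong_sym (reduce_cong _ _ _))).
have sum_cong (f g : 'I_n -> rat) : (forall i, cong p 0 (f i) (g i)) ->
    cong p 0 (\sum_i f i) (\sum_i g i).
  by move=> h; elim/big_ind2: _ => //; [exact: cong_refl|move=> *; exact: cong_add].
rewrite -sumrN; apply: sum_cong => i.
rewrite -mulrN ![padic_res (xi i) _ * _]mulrC.
have -> : (0 : int) = m%:Z + - m%:Z by rewrite subrr.
apply: (cong_mulr hp); first by rewrite /oppQpn (res_opp hp); exact: reduce_cong.
by apply: (res_cong0 hp) => //; lia.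
Qed.

Definition cphase xi x : R := cos (2 * pi * ratr (phase xi x)).
Definition sphase xi x : R := sin (2 * pi * ratr (phase xi x)).

Lemma trig_cong (r s : rat) : cong p 0 r s ->
  cos (2 * pi * ratr r) = cos (2 * pi * ratr s) :> R /\
  sin (2 * pi * ratr r) = sin (2 * pi * ratr s) :> R.
Proof.
move=> [z]; rewrite expr0z mul1r => h.
have -> : r = s + z%:~R by rewrite -h; ring.
have nat_case (t : R) (k : nat) : cos (2 * pi * (t + k%:R)) = cos (2 * pi * t) /\
    sin (2 * pi * (t + k%:R)) = sin (2 * pi * t).
  have -> : 2 * pi * (t + k%:R) = 2 * pi * t + pi *+ 2 *+ k.
    by rewrite -[_ *+ k]mulr_natr -[pi *+ 2]mulr_natr; ring.
  by rewrite (periodicn (@cosD2pi R)) (periodicn (@sinD2pi R)).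
rewrite rmorphD /= ratr_int; case: z {h} => k; first exact: nat_case.
(* For negative z, periodicity is used at the shifted point, whose translate by k + 1 is
   [ratr s]. *)
have [] := nat_case (ratr s + (Negz k)%:~R) k.+1.
rewrite -addrA NegzE intrN (_ : (k.+1 : int)%:~R = k.+1%:R :> R) ?pmulrn //.
by rewrite addNr addr0 => -> ->.
Qed.

Lemma sphase_opp xi x : sphase xi (oppQpn x) = - sphase xi x.
Proof. by rewrite /sphase (trig_cong (phase_opp xi x)).2 rmorphN /= mulrN sinN. Qed.

Lemma cphase_loc xi x : exists N, forall y, cyl N x y -> cphase xi y = cphase xi x.
Proof.
have [m1 h1] := cyl_bounded hp xi; have [m2 h2] := cyl_bounded hp x.
exists (maxn m1 m2)%:Z => y xy; rewrite /cphase (@phase_eq (maxn m1 m2) xi xi x y) //.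
  by apply: cyl_le h1 => //; rewrite lerN2 lez_nat leq_maxl.
by apply: cyl_le h2 => //; rewrite lerN2 lez_nat leq_maxr.
Qed.

Lemma sphase_loc xi x : exists N, forall y, cyl N x y -> sphase xi y = sphase xi x.
Proof.
have [m1 h1] := cyl_bounded hp xi; have [m2 h2] := cyl_bounded hp x.
exists (maxn m1 m2)%:Z => y xy; rewrite /sphase (@phase_eq (maxn m1 m2) xi xi x y) //.
  by apply: cyl_le h1 => //; rewrite lerN2 lez_nat leq_maxl.
by apply: cyl_le h2 => //; rewrite lerN2 lez_nat leq_maxr.
Qed.

End Dot.

(** * A frequency near e_1 and a point near p^(-1) e_1 with nontrivial character *)

Section BasisVector.
Variables (R : realType) (p : nat) (hp : prime p) (n : nat).
Local Notation pr := (p%:R : rat).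

Definition baseQpn (r : rat) : Qpn p n.+1 :=
  fun i => if i == ord0 then ratQp p r else Qp0 p.

Lemma res_baseQpn r m N i : cong p m r 0 ->
  padic_res (baseQpn r i) N = if i == ord0 then padic_reduce p N r else 0.
Proof. by rewrite /baseQpn; case: eqP => // _ h; rewrite (res_ratQp hp _ h). Qed.

Lemma cong_one : cong p 0 1 0.
Proof. by exists 1; rewrite subr0 expr0z mul1r. Qed.

Lemma cong_invp : cong p (- 1) pr^-1 0.
Proof. by exists 1; rewrite subr0 mulr1 exprN1. Qed.

Lemma phase_base xi x :
  cyl 1 (baseQpn 1) xi -> cyl 0 (baseQpn pr^-1) x -> phase xi x = padic_reduce p 0 pr^-1.
Proof.
move=> hxi hx; have le1 : - 1 <= 0 :> int by [].
rewrite (@phaseE p hp n.+1 xi x 1 1) //.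
- apply/(reduceP hp); rewrite big_ord_recl big1 => [|i _].
    rewrite addr0 hxi (res_baseQpn _ _ cong_one) eqxx.
    have hx1 : cong p 0 (padic_res (x ord0) 1) pr^-1.
      apply: cong_trans (res_cong hp (x ord0) (_ : 0 <= 1)) _ => //.
      by rewrite hx (res_baseQpn _ _ cong_invp) eqxx; exact: reduce_cong.
    apply: (cong_trans _ hx1); rewrite -{2}[padic_res (x ord0) 1]mul1r.
    (* [xi] is known only modulo p, but x lies in p^(-1) Z_p, so the product is fixed modulo Z_p. *)
    apply: (cong_mulr hp (M := 1) (N := - 1)); first exact: reduce_cong.
    apply: cong_trans (cong_le hp le1 hx1) _; exact: cong_invp.
  by rewrite hxi (res_baseQpn _ _ cong_one) mul0r.
- move=> i; apply/(res_eqP hp).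
  apply: cong_trans (cong_sym (res_cong hp (xi i) (_ : - 1 <= 1))) _ => //.
  rewrite hxi (res_baseQpn _ _ cong_one); case: eqP => _; last exact: cong_refl.
  apply: cong_trans (cong_le hp (_ : - 1 <= 1) (reduce_cong _ _ _)) _ => //.
  exact: (cong_le hp le1 cong_one).
- move=> i; apply/(res_eqP hp).
  apply: cong_trans (cong_sym (res_cong hp (x i) le1)) _.
  rewrite hx (res_baseQpn _ _ cong_invp); case: eqP => _; last exact: cong_refl.
  apply: cong_trans (cong_le hp le1 (reduce_cong _ _ _)) _.
  exact: cong_invp.
Qed.

Lemma cphase_base xi x :
  cyl 1 (baseQpn 1) xi -> cyl 0 (baseQpn pr^-1) x ->
  cphase R xi x = cos (2 * pi / p%:R).
Proof.
move=> hxi hx; rewrite /cphase (phase_base hxi hx).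
rewrite (trig_cong R (reduce_cong p 0 pr^-1)).1.
by have -> : ratr pr^-1 = (p%:R)^-1 :> R by rewrite fmorphV /= ratr_nat.
Qed.

Lemma cos_2pi_div_lt1 : cos (2 * pi / p%:R) < 1 :> R.
Proof.
have p2 : (2 : R) <= p%:R by rewrite ler_nat prime_gt1.
have p0 : (0 : R) < p%:R by rewrite (lt_le_trans _ p2).
have -> : 2 * pi / p%:R = (pi / p%:R) *+ 2 :> R by rewrite -[RHS]mulr_natl mulrA.
have : 0 < sin (pi / p%:R : R).
  apply: sin_gt0_pi; rewrite divr_gt0 ?pi_gt0 //= ltr_pdivrMr // ltr_pMr ?pi_gt0 //.
  by rewrite (lt_le_trans _ p2) // ltr1n.
rewrite cos_mulr2n cos2sin2 => h.
have := exprn_gt0 2 h; lra.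
Qed.

End BasisVector.

(** * Haar measure *)

Lemma measure_bigsetU_le d (T : measurableType d) (R : realType)
    (m : {measure set T -> \bar R})
    (I : Type) (s : seq I) (F : I -> set T) (c : R) :
  (forall i, measurable (F i)) -> (forall i, (m (F i) <= c%:E)%E) ->
  (m (\big[setU/set0]_(i <- s) F i) <= ((size s)%:R * c)%:E)%E.
Proof.
move=> mF hF; elim: s => [|i s IH]; first by rewrite big_nil measure0 mul0r.
have ms : measurable (\big[setU/set0]_(j <- s) F j) by exact: bigsetU_measurable.
rewrite big_cons; apply: le_trans (measureU2 m (mF i) ms) _.
by rewrite /= -natr1 mulrDl mul1r EFinD addeC leeD.
Qed.

Section Haar.
Variables (R : realType) (p : nat) (hp : prime p) (n : nat).
Variable mu : {measure set (QpnB R p n) -> \bar R}.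
Hypothesis mu_inv : forall (a : QpnB R p n) (E : set (QpnB R p n)), measurable E ->
     mu [set addQpn a y | y in E] = mu E.
Hypothesis mu_Zpn : mu (Zpn R p n) = 1%E.
Local Notation pR := (p%:R : R).
Local Notation pr := (p%:R : rat).
Local Notation zero := (zeroQpn p n).

Lemma mu_cyl N x : mu (cyl N x) = mu (cyl N zero).
Proof. rewrite (cyl_add hp N x); by apply: mu_inv; exact: (measurable_cyl hp). Qed.

Lemma mu_cyl0 : mu (cyl 0 zero) = 1%E.
Proof. by rewrite -mu_Zpn (Zpn_cyl R hp). Qed.

(** The ball of level N - 1 is covered by p^n balls of level N, one for each vector of digits; the
    union bound gives the upper estimate. *)
Lemma mu_cyl_pred N (c : R) : (mu (cyl N zero) <= c%:E)%E ->
  (mu (cyl (N - 1) zero) <= ((p ^ n)%:R * c)%:E)%E.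
Proof.
move=> hc.
pose F (f : {ffun 'I_n -> 'I_p}) : set (QpnB R p n) :=
  [set x | forall i, padic_res (x i) N = padic_reduce p N (pr ^ (N - 1) * (f i : nat)%:R)].
(* Admitting [set0] saves exhibiting a vector with the prescribed residues. *)
have FE f : F f = set0 \/ exists x, F f = cyl N x.
  have [->|/set0P[x Fx]] := eqVneq (F f) set0; [by left|right; exists x].
  by apply/seteqP; split=> y hy i; rewrite hy Fx.
have mF f : measurable (F f).
  by have [->|[x ->]] := FE f; [exact: measurable0|exact: (measurable_cyl hp)].
have hF f : (mu (F f) <= c%:E)%E.
  have [->|[x ->]] := FE f; last by rewrite mu_cyl.
  by rewrite measure0; exact: le_trans (measure_ge0 _ _) hc.
have -> : (p ^ n)%N = size (index_enum {ffun 'I_n -> 'I_p}).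
  by rewrite -[index_enum _]enumT -cardE card_ffun !card_ord.
apply: le_trans (measure_bigsetU_le (index_enum _) mF hF).
apply: le_measure; rewrite ?inE.
- exact: (measurable_cyl hp).
- exact: bigsetU_measurable.
move=> x hx.
have /cid[f hf] : exists f : 'I_n -> 'I_p, forall i,
    padic_res (x i) N = padic_reduce p N (pr ^ (N - 1) * (f i : nat)%:R).
  apply: (@fin_all_exists _ _ (fun i (k : 'I_p) =>
    padic_res (x i) N = padic_reduce p N (pr ^ (N - 1) * (k : nat)%:R))) => i.
  (* The residue at N is p^(N-1) z, and its digit is z modulo p. *)
  have [z hz] : cong p (N - 1) (padic_res (x i) N) 0.
    by apply: (res_cong0 hp); [lia|exact: hx].
  have p0 : (p%:Z != 0) by rewrite eqz_nat -lt0n prime_gt0.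
  have zp : (`|(z %% p%:Z)%Z| < p)%N.
    have := ltz_pmod z (_ : 0 < p%:Z); rewrite ltz_nat prime_gt0 // => /(_ isT).
    by have := modz_ge0 z p0; case: (z %% p%:Z)%Z.
  exists (Ordinal zp); rewrite -[LHS]res_reduce; apply/(reduceP hp).
  exists (z %/ p%:Z)%Z; rewrite subr0 in hz; rewrite hz /=.
  have -> : (`|(z %% p%:Z)%Z|%N)%:R = ((z %% p%:Z)%Z)%:~R :> rat.
    by rewrite -{2}[(z %% p)%Z]gez0_abs ?modz_ge0.
  have -> : pr ^ N = pr ^ (N - 1) * pr.
    by rewrite -{1}(subrK 1 N) expfzDr ?(p_neq0 hp) // expr1z.
  rewrite {1}(divz_eq z p%:Z) rmorphD rmorphM /= (_ : p%:Z%:~R = pr) //; ring.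
rewrite (bigD1_seq [ffun i => f i]) ?mem_index_enum ?index_enum_uniq //=.
by left => i; rewrite ffunE.
Qed.

Lemma mu_cyl_iter N (k : nat) (c : R) : (mu (cyl N zero) <= c%:E)%E ->
  (mu (cyl (N - k%:Z) zero) <= ((p ^ n)%:R ^+ k * c)%:E)%E.
Proof.
move=> hc; elim: k => [|k IH]; first by rewrite subr0 mul1r.
have -> : N - k.+1%:Z = N - k%:Z - 1 by lia.
by rewrite exprS -mulrA; exact: mu_cyl_pred.
Qed.

Lemma mu_ball_le (k : nat) : (mu (cyl (- k%:Z) zero) <= ((p ^ n)%:R ^+ k)%:E)%E.
Proof.
have := @mu_cyl_iter 0 k 1; rewrite sub0r mulr1; apply.
by rewrite mu_cyl0.
Qed.

(** The lower bound comes out of the upper one: k steps of [mu_cyl_iter] lead from this ball to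
    Z_p^n, so 1 <= p^(nk) times its measure. *)
Lemma mu_ball_ge (k : nat) : (((p ^ n)%:R ^- k)%:E <= mu (cyl k%:Z zero))%E.
Proof.
have pn0 : 0 < (p ^ n)%:R ^+ k :> R by rewrite exprn_gt0 // ltr0n expn_gt0 prime_gt0.
have le1 : (mu (cyl k%:Z zero) <= 1)%E.
  rewrite -mu_cyl0; apply: le_measure; rewrite ?inE; try exact: (measurable_cyl hp).
  by move=> x; apply: cyl_le.
have fin : mu (cyl k%:Z zero) \is a fin_num.
  by rewrite ge0_fin_numE //; apply: le_lt_trans le1 _; rewrite ltey.
have := @mu_cyl_iter k%:Z k (fine (mu (cyl k%:Z zero))).
rewrite subrr fineK // lexx mu_cyl0 => /(_ isT).
rewrite lee_fin => h; rewrite -(fineK fin) lee_fin.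
by rewrite -[_ ^- k]mul1r ler_pdivrMr // mulrC.
Qed.

(** The empty set is included for closure under intersection, two balls being nested or disjoint. *)
Definition cylinders : set (set (QpnB R p n)) :=
  [set A | A = set0 \/ exists N x, A = cyl N x].

Lemma cylinders_setI : setI_closed cylinders.
Proof.
move=> A B [->|[N [x ->]]]; first by rewrite set0I; left.
case=> [->|[M [y ->]]]; first by rewrite setI0; left.
have [->|/set0P[z [xz yz]]] := eqVneq (cyl N x `&` cyl M y) set0; first by left.
right; exists (Num.max N M), z; apply/seteqP; split=> w.
  move=> [xw yw]; have [NM|MN] := leP N M.
    exact: cyl_trans (cyl_sym yz) yw.
  exact: cyl_trans (cyl_sym xz) xw.
move=> zw; split; [apply: cyl_trans xz _|apply: cyl_trans yz _];
  by apply: cyl_le zw; rewrite ?le_max ?lexx ?orbT.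
Qed.

(* Q_p^n is second countable: residues are rational, so there are only
   countably many cylinders. *)
Lemma measurable_cylinders : @measurable _ (QpnB R p n) = <<s cylinders >>.
Proof.
apply/seteqP; split; apply: smallest_sub; try exact: smallest_sigma_algebra; last first.
  by move=> _ [->|[N [x ->]]]; [exact: measurable0|exact: (measurable_cyl hp)].
move=> U /padic_openP oU; have {}oU := oU hp.
pose T := (int * {ffun 'I_n -> rat})%type.
pose S (t : T) : set (QpnB R p n) := [set y | forall i, padic_res (y i) t.1 = t.2 i].
pose F (k : nat) : set (QpnB R p n) :=
  if @unpickle T k is Some t then if `[< S t `<=` U >] then S t else set0 else set0.
have -> : U = \bigcup_k F k.
  apply/seteqP; split=> [x Ux|x [k _]]; last first.
    by rewrite /F; case: unpickle => // t; case: asboolP => // + Stx; apply.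
  have [N hN] := oU x Ux.
  exists (pickle ((N, [ffun i => padic_res (x i) N]) : T)); first exact: I.
  rewrite /F pickleK; case: asboolP => [_ i|]; first by rewrite ffunE.
  by case=> y hy; apply: hN => i; rewrite hy /= ffunE.
have [s0 sC sU] := smallest_sigma_algebra setT cylinders.
apply: sU => k; rewrite /F; case: unpickle => // t; case: asboolP => // _.
apply: sub_sigma_algebra; have [->|/set0P[x Sx]] := eqVneq (S t) set0; first by left.
by right; exists t.1, x; apply/seteqP; split=> y hy i; rewrite hy Sx.
Qed.

Lemma oppQpn_cyl N x : @oppQpn p n @^-1` cyl N x = cyl N (oppQpn x).
Proof.
have h (u v : Qpn p n) : cyl N u (oppQpn v) -> cyl N (oppQpn u) v.
  move=> uv i; rewrite -[LHS]res_reduce /oppQpn (res_opp hp (u i)).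
  apply/(reduceP hp); rewrite -uv /oppQpn (res_opp hp (v i)).
  by apply: cong_sym; rewrite -[X in cong _ _ _ X]opprK; apply: cong_opp; exact: reduce_cong.
apply/seteqP; split=> y; first exact: h.
by move=> /cyl_sym hy; apply/cyl_sym/h/hy.
Qed.

Lemma measurable_oppQpn :
  measurable_fun setT (@oppQpn p n : QpnB R p n -> QpnB R p n).
Proof.
apply: (measurability _ measurable_cylinders) => _ [A [->|[N [x ->]]] <-].
  by rewrite preimage_set0 setI0; exact: measurable0.
by rewrite setTI oppQpn_cyl; exact: (measurable_cyl hp).
Qed.

(* By uniqueness of measures it is enough to compare the two sides on cylinders. *)
Lemma mu_oppQpn (E : set (QpnB R p n)) : measurable E ->
  mu (@oppQpn p n @^-1` E) = mu E.
Proof.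
move=> mE.
pose T := QpnB R p n.
pose f : T -> T := @oppQpn p n.
have mf : measurable_fun setT f := measurable_oppQpn.
pose m2 : {measure set T -> \bar R} :=
  measure_function_pushforward__canonical__measure_function_Measure mu mf.
have := @measure_unique _ _ _ cylinders (fun k : nat => cyl (- k%:Z) zero)
  measurable_cylinders cylinders_setI _ _ m2 mu _ _ E mE.
apply.
- by move=> k; right; exists (- k%:Z), zero.
- by apply/seteqP; split=> // x _; have [k hk] := cyl_bounded hp x; exists k.
- move=> _ [->|[N [x ->]]]; first by rewrite !measure0.
  by rewrite [LHS]/= /pushforward [f @^-1` _]oppQpn_cyl !mu_cyl.
- move=> k; rewrite /= /pushforward [f @^-1` _]oppQpn_cyl mu_cyl.
  by apply: le_lt_trans (mu_ball_le k) _; rewrite ltry.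
Qed.

End Haar.

(** * The symbol 1 - Jhat *)

Section Symbol.
Variables (R : realType) (p : nat) (hp : prime p) (n : nat).
Local Notation T := (QpnB R p n).
Variable mu : {measure set T -> \bar R}.
Hypothesis mu_inv : forall (a : T) (E : set T), measurable E ->
     mu [set addQpn a y | y in E] = mu E.
Hypothesis mu_Zpn : mu (Zpn R p n) = 1%E.
Variable J : R -> R.
Hypothesis J_ge0 : forall r, 0 < r -> 0 <= J r.
Hypothesis J_int : (\int[mu]_(x in setT) (J (normQpn R x))%:E = 1)%E.
Local Notation pR := (p%:R : R).
Local Notation zero := (zeroQpn p n).
Implicit Types (x y xi : T) (k : nat).

Definition Jnorm x : R := J (normQpn R x).

(* The origin is exempted because x |-> J (normQpn R x) need not be locally
   constant there. *)
Definition locally_const (f : T -> R) :=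
  forall x, x <> zero -> exists N, forall y, cyl N x y -> f y = f x.

Lemma measurable_locally_const f : locally_const f -> measurable_fun setT f.
Proof.
move=> hf; apply: (measurable_cyl_cont hp) => x x0 e e0.
by have [N hN] := hf x x0; exists N => y /hN ->; rewrite subrr normr0.
Qed.

Lemma locally_const2 (op : R -> R -> R) f g :
  locally_const f -> locally_const g -> locally_const (fun x => op (f x) (g x)).
Proof.
move=> hf hg x x0; have [N hN] := hf x x0; have [M hM] := hg x x0.
exists (Num.max N M) => y xy; rewrite hN ?hM //;
  by apply: cyl_le xy => //; rewrite le_max lexx ?orbT.
Qed.

Lemma Jnorm_locally_const : locally_const Jnorm.
Proof.
move=> x /neq_cyl[] // N hN; exists N => y xy.
by rewrite /Jnorm (normQpn_cyl R hp hN xy).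
Qed.

Lemma cphase_locally_const xi : locally_const (cphase R xi).
Proof. by move=> x _; exact: cphase_loc. Qed.

Lemma sphase_locally_const xi : locally_const (sphase R xi).
Proof. by move=> x _; exact: sphase_loc. Qed.

Lemma Jnorm_ge0 x : x <> zero -> 0 <= Jnorm x.
Proof. by move=> x0; apply/J_ge0/(normQpn_gt0 R hp). Qed.

Lemma Jnorm_ge0_tail k x : ~ cyl (- k%:Z) zero x -> 0 <= Jnorm x.
Proof. by move=> hx; apply: Jnorm_ge0 => x0; apply: hx; rewrite x0. Qed.

(** Since J(0) may be negative, [J_int] does not give integrability by positivity. But the integral
    is the difference of those of the positive and negative parts, and it can equal 1 only if both
    are finite. *)
Lemma integrable_Jnorm : mu.-integrable setT (EFin \o Jnorm).
Proof.
have mJ : measurable_fun setT (EFin \o Jnorm).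
  by apply/measurable_EFinP; apply: measurable_locally_const; exact: Jnorm_locally_const.
apply/integrableP; split => //.
pose f (x : T) := (Jnorm x)%:E.
rewrite (_ : integral _ _ _ = (\int[mu]_x (f^\+ x + f^\- x))%E); last first.
  by apply: eq_integral => x _; rewrite -[LHS]/((abse \o f) x) fune_abse.
rewrite ge0_integralD //; [|exact/measurable_funepos|exact/measurable_funeneg].
set a := (\int[mu]_x f^\+ x)%E; set b := (\int[mu]_x f^\- x)%E.
have a0 : (0 <= a)%E by apply: integral_ge0.
have b0 : (0 <= b)%E by apply: integral_ge0.
have : (a - b = 1)%E by rewrite -integralE J_int.
by case: (a) a0 => [r| |] //; case: (b) b0 => [s| |] //= _ _ _; rewrite ltry.
Qed.

Lemma integrable_Jnorm_mul (h : T -> R) (c : R) :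
    locally_const h -> (forall x, `|h x| <= c) ->
  mu.-integrable setT (EFin \o (fun x => h x * Jnorm x)).
Proof.
move=> lh hc; apply: (le_integrable measurableT _ _ (integrableZl measurableT c integrable_Jnorm)).
  apply/measurable_EFinP; apply: measurable_locally_const.
  exact: locally_const2 lh Jnorm_locally_const.
move=> x _; rewrite /= lee_fin !normrM ler_wpM2r //.
exact: le_trans (hc x) (ler_norm _).
Qed.

Lemma measurable_tail k : measurable (~` cyl (- k%:Z) zero : set T).
Proof. by apply: measurableC; exact: (measurable_cyl hp). Qed.

Definition Jtail k : R := Rintegral mu (~` cyl (- k%:Z) zero) Jnorm.

Lemma Rintegral_tail_le (h : T -> R) (c : R) k :
    mu.-integrable setT (EFin \o h) ->
    (forall x, cyl (- k%:Z) zero x -> h x = 0) ->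
    (forall x, ~ cyl (- k%:Z) zero x -> `|h x| <= c * Jnorm x) ->
  `|Rintegral mu setT h| <= c * Jtail k.
Proof.
move=> ih h0 hc; apply: le_trans (le_normr_Rintegral measurableT ih) _.
have mt := @measurable_tail k.
have it f : mu.-integrable setT (EFin \o f) ->
    mu.-integrable (~` cyl (- k%:Z) zero : set T) (EFin \o f).
  by apply: integrableS => //; exact: measurableT.
have -> : Rintegral mu setT (fun x => `|h x|) =
    Rintegral mu (~` cyl (- k%:Z) zero) (fun x => `|h x|).
  rewrite [RHS]Rintegral_mkcond; apply: eq_Rintegral => x _.
  rewrite patchE; case: ifPn => // /negP; rewrite inE /= => /contrapT /h0 ->.
  by rewrite normr0.
rewrite -RintegralZl //; last exact/it/integrable_Jnorm.
apply: le_Rintegral => //.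
- exact/it/integrable_norm.
- by apply: it; apply: (integrableZl measurableT c integrable_Jnorm).
Qed.

(* 1 - Jhat *)
Definition symb xi : R := Rintegral mu setT (fun x => (1 - cphase R xi x) * Jnorm x).

Lemma norm_1Bcphase xi x : `|1 - cphase R xi x| <= 2.
Proof.
have := cos_le1 (2 * pi * ratr (phase xi x) : R).
have := cos_geN1 (2 * pi * ratr (phase xi x) : R).
by rewrite -/(cphase R xi x) ler_norml => h1 h2; apply/andP; split; lra.
Qed.

Lemma locally_const_1Bcphase xi : locally_const (fun x => 1 - cphase R xi x).
Proof.
apply: (@locally_const2 (fun a b => 1 - b) _ _ _ (cphase_locally_const xi)).
exact: cphase_locally_const.
Qed.

Lemma integrable_symb xi :
  mu.-integrable setT (EFin \o (fun x => (1 - cphase R xi x) * Jnorm x)).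
Proof.
exact: (integrable_Jnorm_mul (locally_const_1Bcphase xi) (norm_1Bcphase xi)).
Qed.

Lemma phase_zero xi : phase xi zero = 0.
Proof.
have [k hk] := cyl_bounded hp xi.
rewrite (@phaseE _ hp _ _ _ k k%:Z) // big1 ?reduce0 // => i _.
by rewrite mulr0.
Qed.

Lemma cphase_zero xi : cphase R xi zero = 1.
Proof. by rewrite /cphase phase_zero rmorph0 mulr0 cos0. Qed.

(** At the origin, where the sign of J is unknown, the character equals 1 and the product
    vanishes. *)
Lemma symb_integrand_ge0 xi x : 0 <= (1 - cphase R xi x) * Jnorm x.
Proof.
have [->|x0] := pselect (x = zero); first by rewrite cphase_zero subrr mul0r.
by rewrite mulr_ge0 ?subr_ge0 ?cos_le1 //; exact: Jnorm_ge0.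
Qed.

Lemma symb_ge0 xi : 0 <= symb xi.
Proof. by apply: Rintegral_ge0 => x _; exact: symb_integrand_ge0. Qed.

Lemma cphase_small k xi x : cyl k%:Z zero xi -> cyl (- k%:Z) zero x -> cphase R xi x = 1.
Proof. by move=> h1 h2; rewrite /cphase (phase_eq0 hp h1 h2) rmorph0 mulr0 cos0. Qed.

(** The character of [xi] is trivial on |x| <= p^k, so only the tail contributes, with 1 - cos at
    most 2. *)
Lemma symb_le k xi : cyl k%:Z zero xi -> symb xi <= 2 * Jtail k.
Proof.
move=> hxi; apply: le_trans (ler_norm _) _; apply: Rintegral_tail_le.
- exact: integrable_symb.
- by move=> x hx; rewrite (cphase_small hxi hx) subrr mul0r.
- move=> x /Jnorm_ge0_tail h; rewrite normrM [`|Jnorm x|]ger0_norm // ler_wpM2r //.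
  exact: norm_1Bcphase.
Qed.

(** A modulus of continuity, from which [measurable_symb] is obtained: on |x| <= p^k the two phases
    agree by [phase_eq]. *)
Lemma symb_dist k xi xi' : cyl (- k%:Z) zero xi -> cyl k%:Z xi xi' ->
  `|symb xi' - symb xi| <= 2 * Jtail k.
Proof.
move=> hxi hxi'; rewrite /symb -RintegralB //; try exact: integrable_symb.
apply: Rintegral_tail_le.
- exact: (integrableB measurableT (integrable_symb xi') (integrable_symb xi)).
- by move=> x hx; rewrite /cphase (@phase_eq _ hp _ k xi xi' x x) // subrr.
- move=> x /Jnorm_ge0_tail h; rewrite -mulrBl normrM [`|Jnorm x|]ger0_norm // ler_wpM2r //.
  have -> : 1 - cphase R xi' x - (1 - cphase R xi x) = cphase R xi x - cphase R xi' x.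
    by ring.
  have := cos_le1 (2 * pi * ratr (phase xi x) : R).
  have := cos_geN1 (2 * pi * ratr (phase xi x) : R).
  have := cos_le1 (2 * pi * ratr (phase xi' x) : R).
  have := cos_geN1 (2 * pi * ratr (phase xi' x) : R).
  rewrite -/(cphase R xi x) -/(cphase R xi' x) ler_norml => *.
  by apply/andP; split; lra.
Qed.

Lemma integrable_sphase xi : mu.-integrable setT (EFin \o (fun x => sphase R xi x * Jnorm x)).
Proof.
by apply: (integrable_Jnorm_mul (c := 1) (sphase_locally_const xi)) => x; exact: sin_max.
Qed.

Lemma normQpn_opp x : normQpn R (oppQpn x) = normQpn R x.
Proof.
rewrite /normQpn; apply: eq_bigr => i _; rewrite /oppQpn /normQp.
congr inf; apply/seteqP; split=> _ [m hm <-]; exists m => //=; last first.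
  by rewrite (res_opp hp) hm oppr0 reduce0.
move: hm => /=; rewrite (res_opp hp) -{1}(reduce0 p m) => /(reduceP hp) /cong_opp.
rewrite opprK oppr0 => h; apply/(res_eqP hp (x i) (Qp0 p) m); exact: h.
Qed.

Lemma Rintegral_sphase xi : Rintegral mu setT (fun x => sphase R xi x * Jnorm x) = 0.
Proof.
set S := Rintegral _ _ _; suff : S = - S by lra.
have mo := @measurable_oppQpn R p hp n.
have mf : measurable_fun setT (EFin \o (fun x => sphase R xi x * Jnorm x)).
  by have /integrableP[] := integrable_sphase xi.
have opp x : sphase R xi (oppQpn x) * Jnorm (oppQpn x) = -1 * (sphase R xi x * Jnorm x).
  by rewrite (sphase_opp R hp) /Jnorm normQpn_opp mulN1r mulNr.
have -> : - S = Rintegral mu setT (fun x => sphase R xi (oppQpn x) * Jnorm (oppQpn x)).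
  under eq_Rintegral do rewrite opp.
  by rewrite RintegralZl ?mulN1r //; exact: integrable_sphase.
rewrite /S /Rintegral; congr fine.
have := @integral_pushforward _ _ T T R _ mo mu setT _ mf _ measurableT.
rewrite preimage_setT => <-.
  apply: eq_measure_integral => A mA _.
  exact: (esym (mu_oppQpn hp mu_inv mu_Zpn mA)).
apply: eq_integrable (integrableZl measurableT (-1) (integrable_sphase xi)) => //.
by move=> x _ /=; rewrite opp.
Qed.

Lemma JhatE xi : Jhat mu J xi = (1 - symb xi)%:C%C.
Proof.
rewrite /Jhat /cintegral; apply/eqP; rewrite eq_complex /=; apply/andP; split; apply/eqP.
  rewrite -[X in X - symb xi](_ : Rintegral mu setT Jnorm = 1); last first.
    by rewrite /Rintegral J_int.
  rewrite /symb -RintegralB //; [|exact: integrable_Jnorm|exact: integrable_symb].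
  by apply: eq_Rintegral => x _; rewrite mulr0 subr0 /cphase /phase /Jnorm /=; ring.
rewrite -[RHS](Rintegral_sphase xi); apply: eq_Rintegral => x _.
by rewrite mulr0 add0r.
Qed.

End Symbol.

(** * Tail of the kernel *)

Lemma expr_small (R : realType) (x e : R) : 0 <= x < 1 -> 0 < e ->
  exists k0 : nat, forall k, (k0 <= k)%N -> x ^+ k < e.
Proof.
move=> /andP[x0 x1] e0.
have /cvgrPdist_lt/(_ e e0)[k0 _ hk] : x ^+ i @[i --> \oo] --> 0.
  by apply: cvg_expr; rewrite ger0_norm.
exists k0 => k /hk /=; rewrite sub0r normrN ger0_norm //; exact: exprn_ge0.
Qed.

(** One term of the exponential series bounds e^(cq) from below, whence K = (m+1)!/c^(m+1). *)
Lemma expR_poly_decay (R : realType) (c : R) (m : nat) : 0 < c ->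
  exists2 K : R, 0 < K & forall q, 0 < q -> expR (- c * q) <= K / q ^+ m.+1.
Proof.
move=> c0; exists (m.+1`!%:R / c ^+ m.+1).
  by rewrite divr_gt0 ?exprn_gt0 // ltr0n fact_gt0.
move=> q q0; have f0 : (0 : R) < m.+1`!%:R by rewrite ltr0n fact_gt0.
have cq : 0 < c * q by exact: mulr_gt0.
have := expR_ge1Dxn m (ltW cq) => h.
rewrite mulNr expRN invf_ple ?posrE ?expR_gt0 //; last by rewrite !divr_gt0 ?exprn_gt0.
apply: le_trans h; rewrite -mulrA -invfM -exprMn invf_div.
by rewrite ler_wpDl.
Qed.

Section TailBound.
Variables (R : realType) (p : nat) (hp : prime p) (n : nat).
Local Notation T := (QpnB R p n).
Variable mu : {measure set T -> \bar R}.
Hypothesis mu_inv : forall (a : T) (E : set T), measurable E ->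
     mu [set addQpn a y | y in E] = mu E.
Hypothesis mu_Zpn : mu (Zpn R p n) = 1%E.
Variable J : R -> R.
Hypothesis J_ge0 : forall r, 0 < r -> 0 <= J r.
Local Notation pR := (p%:R : R).
Local Notation zero := (zeroQpn p n).
Variables (gamma B C1 : R).
Hypotheses (gamma_le0 : gamma <= 0) (B_gt0 : 0 < B) (C1_gt0 : 0 < C1).
Hypothesis J_le : forall x : T, normQpn R x != 0 ->
  J (normQpn R x) <= B * (normQpn R x `^ gamma) * expR (- C1 * normQpn R x).

(** The sphere |x| = p^(i+1). *)
Let shell (i : nat) : set T := cyl (- i.+1%:Z) zero `\` cyl (- i%:Z) zero.

Let measurable_shell i : measurable (shell i).
Proof. by apply: measurableD; exact: (measurable_cyl hp). Qed.

(** Here |x| >= p^(i+1) >= 1, so the power with exponent gamma <= 0 is at most 1 and the exponential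
    alone remains. *)
Lemma Jnorm_shell_le (i : nat) (x : T) : ~ cyl (- i%:Z) zero x ->
  Jnorm J x <= B * expR (- C1 * pR ^+ i.+1).
Proof.
move=> hx; have q_le : pR ^+ i.+1 <= normQpn R x.
  by have := normQpn_ge R hp hx; rewrite opprK (_ : 1 + i%:Z = i.+1%:Z) // -exprnP.
have q1 : 1 <= pR ^+ i.+1 by rewrite exprn_ege1 // ltW // (pR_gt1 R hp).
have n0 : 0 < normQpn R x by apply: lt_le_trans q_le; exact: lt_le_trans q1.
apply: le_trans (J_le (lt0r_neq0 n0)) _.
rewrite -mulrA ler_wpM2l ?(ltW B_gt0) //.
apply: (@le_trans _ _ (1 * expR (- C1 * normQpn R x))).
  rewrite ler_wpM2r ?expR_ge0 // -[leRHS](powRr0 (normQpn R x)) ler_powR //.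
  exact: le_trans q_le.
by rewrite mul1r ler_expR !mulNr lerN2 ler_wpM2l // ltW.
Qed.

Lemma Jtail_le : exists2 K : R, 0 < K &
  forall k : nat, Jtail mu J k <= K / (pR ^+ n.+1) ^+ k.
Proof.
(* Decay of order q^(-2n-1): the measure of a shell takes q^n of it, and q^(-n-1) is left. *)
have [K K0 hK] := @expR_poly_decay R C1 (n + n) C1_gt0.
exists (B * K) => [|k]; first exact: mulr_gt0.
have p0 := pR_gt0 R hp.
have eps0 : 0 <= B * K / (pR ^+ n.+1) ^+ k.
  by rewrite divr_ge0 ?exprn_ge0 ?mulr_ge0 // ltW.
suff : (\int[mu]_(x in ~` cyl (- k%:Z) zero) (Jnorm J x)%:E <=
    (B * K / (pR ^+ n.+1) ^+ k)%:E)%E.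
  move=> h; have : (0 <= \int[mu]_(x in ~` cyl (- k%:Z) zero) (Jnorm J x)%:E)%E.
    by apply: integral_ge0 => x /= hx; rewrite lee_fin; exact: (Jnorm_ge0_tail hp J_ge0 hx).
  by rewrite /Jtail /Rintegral; case: integral h => [r| |] //=; rewrite lee_fin.
have mJ := measurable_locally_const hp (Jnorm_locally_const hp J).
have -> : ~` cyl (- k%:Z) zero = \bigcup_j shell (k + j).
  apply/seteqP; split=> [x hx|x [j _ [_ hx]]]; last first.
    by move=> h; apply: hx; apply: cyl_le h => //; lia.
  have [m hm] := cyl_bounded hp x.
  have : exists j, `[< cyl (- (k + j)%:Z) zero x >].
    by exists m; apply/asboolP; apply: cyl_le hm => //; lia.
  move=> /ex_minnP[[|j] /asboolP hj minj].
    by rewrite addn0 in hj.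
  exists j => //; split; first by rewrite -addnS.
  by move=> h; have := minj j; rewrite ltnn => F; apply/notF/F/asboolP.
rewrite ge0_integral_bigcup //; last 3 first.
- by apply/measurable_EFinP/measurable_funTS.
- by move=> x [j _ [_ hx]]; rewrite lee_fin; exact: (Jnorm_ge0_tail hp J_ge0 hx).
- apply/trivIsetP => i j _ _; wlog ij : i j / (i < j)%N.
    move=> H; rewrite neq_ltn => /orP[ij|ji]; first by apply: H => //; rewrite ltn_eqF.
    by rewrite setIC; apply: H => //; rewrite ltn_eqF.
  move=> _; apply/seteqP; split=> // x [[hx _] [_ hx']]; apply: hx'.
  by apply: cyl_le hx => //; lia.
(* Shell j receives the share 2^(-j-1) of the bound; this is affordable because p^(-(n+1)(j+1)) <=
   2^(-j-1). *)
apply: le_trans (epsilon_trick0 xpredT eps0).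
apply: lee_nneseries => [j _ _|j _].
  by apply: integral_ge0 => x [_ hx]; rewrite lee_fin; exact: (Jnorm_ge0_tail hp J_ge0 hx).
set i := (k + j)%N; pose q := pR ^+ i.+1.
have q0 : 0 < q by rewrite exprn_gt0.
apply: (@le_trans _ _ (\int[mu]_(x in shell i) (cst (B * expR (- C1 * q))%:E) x)%E).
  apply: ge0_le_integral => //.
  - by move=> x [_ hx]; rewrite lee_fin; exact: (Jnorm_ge0_tail hp J_ge0 hx).
  - by apply/measurable_EFinP/measurable_funTS.
  - by move=> x [_ hx]; rewrite lee_fin; exact: Jnorm_shell_le.
rewrite integral_cst //.
apply: (@le_trans _ _ ((B * expR (- C1 * q))%:E * (q ^+ n)%:E)%E).
  apply: lee_wpmul2l; first by rewrite lee_fin mulr_ge0 ?expR_ge0 ?ltW.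
  have -> : q ^+ n = (p ^ n)%:R ^+ i.+1 by rewrite natrX -!exprM mulnC.
  apply: le_trans (mu_ball_le hp mu_inv mu_Zpn i.+1).
  apply: le_measure; rewrite ?inE //; first exact: (measurable_cyl hp).
  by move=> x [].
rewrite lee_fin; apply: (@le_trans _ _ (B * (K / q ^+ (n + n).+1) * q ^+ n)).
  by rewrite ler_wpM2r ?exprn_ge0 ?(ltW q0) // ler_wpM2l ?(ltW B_gt0) // hK.
have -> : B * (K / q ^+ (n + n).+1) * q ^+ n = B * K / q ^+ n.+1.
  rewrite -addSn exprD; field.
  by rewrite !expf_neq0 // gt_eqF.
have -> : q ^+ n.+1 = (pR ^+ n.+1) ^+ k * (pR ^+ n.+1) ^+ j.+1.
  by rewrite -exprD addnS -!exprM mulnC.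
rewrite invfM mulrA ler_wpM2l // lef_pV2 ?posrE ?exprn_gt0 // ?ltr0n ?expn_gt0 //.
rewrite natrX lerXn2r ?nnegrE ?exprn_ge0 ?(ltW p0) //.
apply: (@le_trans _ _ pR); first by rewrite ler_nat prime_gt1.
by rewrite exprS ler_peMr ?(ltW p0) // exprn_ege1 // ltW // (pR_gt1 R hp).
Qed.

End TailBound.

(** * Return probabilities *)

Section ReturnProbability.
Variables (R : realType) (p : nat) (hp : prime p) (n : nat).
Local Notation T := (QpnB R p n).
Variable mu : {measure set T -> \bar R}.
Hypothesis mu_inv : forall (a : T) (E : set T), measurable E ->
     mu [set addQpn a y | y in E] = mu E.
Hypothesis mu_Zpn : mu (Zpn R p n) = 1%E.
Variable J : R -> R.
Hypothesis J_ge0 : forall r, 0 < r -> 0 <= J r.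
Hypothesis J_int : (\int[mu]_(x in setT) (J (normQpn R x))%:E = 1)%E.
Local Notation pR := (p%:R : R).
Local Notation zero := (zeroQpn p n).
Local Notation Z := (Zpn R p n).
Variable K : R.
Hypothesis K_gt0 : 0 < K.
Hypothesis tail_le : forall k : nat, Jtail mu J k <= K / (pR ^+ n.+1) ^+ k.
Local Notation symb := (symb mu J).

Lemma Jtail_small e : 0 < e -> exists k0 : nat, forall k, (k0 <= k)%N -> Jtail mu J k < e.
Proof.
move=> e0; have [||k0 hk0] := @expr_small R (pR ^+ n.+1)^-1 (e / K).
- rewrite invr_ge0 exprn_ge0 ?(ltW (pR_gt0 R hp)) //= invf_lt1 ?exprn_gt0 ?(pR_gt0 R hp) //.
  by rewrite exprn_egt1 // (pR_gt1 R hp).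
- exact: divr_gt0.
exists k0 => k /hk0; rewrite ltr_pdivlMr // exprVn mulrC; exact: le_lt_trans.
Qed.

Lemma measurable_symb : measurable_fun setT symb.
Proof.
apply: (measurable_cyl_cont hp) => xi _ e e0.
have [k0 hk0] := @Jtail_small (e / 2) ltac:(by rewrite divr_gt0).
have [m hm] := cyl_bounded hp xi.
pose k := maxn k0 m; exists k%:Z => xi' hxi'.
have hxi : cyl (- k%:Z) zero xi by apply: cyl_le hm => //; lia.
apply: le_lt_trans (symb_dist hp J_ge0 J_int hxi hxi') _.
by rewrite mulrC -ltr_pdivlMr // hk0 // leq_maxl.
Qed.

Definition return_prob (t : R) : R := Rintegral mu Z (fun xi => expR (- (t * symb xi))).

Lemma expR_symb_le1 t xi : 0 <= t -> expR (- (t * symb xi)) <= 1.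
Proof. by move=> t0; rewrite -expR0 ler_expR oppr_le0 mulr_ge0 // (symb_ge0 hp mu J_ge0). Qed.

Lemma integrable_cst_Z (c : R) : mu.-integrable Z (EFin \o cst c).
Proof.
apply/integrableP; split; first by apply/measurable_EFinP; exact: measurable_cst.
have mZ := @measurable_Zpn R p hp n.
rewrite (eq_integral (cst `|c|%:E)) // (integral_cst mu mZ).
by rewrite mu_Zpn mule1 ltry.
Qed.

Lemma integrable_return_prob t : 0 <= t -> mu.-integrable Z (EFin \o (fun xi => expR (- (t * symb xi)))).
Proof.
move=> t0; have mZ := @measurable_Zpn R p hp n.
apply: (le_integrable mZ _ _ (integrable_cst_Z 1)).
  apply/measurable_EFinP/measurable_funTS; apply: measurableT_comp => //.
  apply: measurableT_comp => //; apply: measurable_funM => //; exact: measurable_symb.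
by move=> x _; rewrite /= lee_fin normr1 ger0_norm ?expR_ge0 // expR_symb_le1.
Qed.

Lemma return_prob_ge0 t : 0 <= return_prob t.
Proof. by apply: Rintegral_ge0 => x _; exact: expR_ge0. Qed.

Lemma return_prob_ge t k : 0 <= t ->
  ((p ^ n)%:R ^- k) * expR (- (t * (2 * Jtail mu J k))) <= return_prob t.
Proof.
move=> t0; have mZ := @measurable_Zpn R p hp n.
have mk := measurable_cyl (R := R) hp k%:Z zero.
set c := expR _; have c0 : 0 <= c := expR_ge0 _.
have hZ : (\int[mu]_(x in Z) (expR (- (t * symb x)))%:E)%E \is a fin_num.
  exact: integrable_fin_num (integrable_return_prob t0).
rewrite -lee_fin /return_prob /Rintegral fineK // mulrC EFinM.
apply: (@le_trans _ _ (c%:E * mu (cyl k%:Z zero))%E).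
  by apply: lee_wpmul2l; [rewrite lee_fin|exact: (mu_ball_ge hp mu_inv mu_Zpn)].
rewrite -(integral_cst mu mk).
have mret : measurable_fun (Z : set T) (fun x => (expR (- (t * symb x)))%:E).
  by have /integrableP[] := integrable_return_prob t0.
have sub : cyl k%:Z zero `<=` Z by rewrite (Zpn_cyl R hp) => x; exact: cyl_le.
apply: (@le_trans _ _ (\int[mu]_(x in cyl k%:Z zero) (expR (- (t * symb x)))%:E)%E).
  apply: ge0_le_integral => //.
  - exact: (measurable_funS mZ sub mret).
  - move=> x hx; rewrite lee_fin ler_expR lerN2 ler_wpM2l //.
    exact: (symb_le hp J_ge0 J_int hx).
by apply: ge0_subset_integral => // x _; rewrite lee_fin expR_ge0.
Qed.

(* Were return_prob 1 equal to 1, the process would never leave Z_p^n. *)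
Lemma return_prob1_lt1_of_ge (W : set T) (d : R) : measurable W -> W `<=` Z -> (0 < mu W)%E ->
  0 < d -> (forall xi, W xi -> d <= symb xi) -> return_prob 1 < 1.
Proof.
move=> mW WZ W0 d0 hd; have mZ := @measurable_Zpn R p hp n.
have W1 : (mu W <= 1)%E by rewrite -mu_Zpn; apply: le_measure; rewrite ?inE.
have finW : mu W \is a fin_num by rewrite ge0_fin_numE // (le_lt_trans W1) ?ltry.
have mD : measurable (Z `\` W : set T) by exact: measurableD.
have iret := integrable_return_prob ler01.
have iS (A : set T) f : measurable A -> A `<=` Z -> mu.-integrable Z (EFin \o f) ->
    mu.-integrable A (EFin \o f).
  by move=> mA AZ; apply: integrableS.
have DZ : (Z `\` W : set T) `<=` Z by move=> x [].
have muD : fine (mu (Z `\` W : set T)) = 1 - fine (mu W).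
  have Zfin : (mu Z < +oo)%E by rewrite mu_Zpn ltey.
  have -> : mu (Z `\` W : set T) = (1 - mu W)%E.
    by rewrite (measureD mZ mW Zfin) (setIidr WZ); congr (_ - _)%E; exact: mu_Zpn.
  by rewrite -(fineK finW) /=.
rewrite /return_prob -(setDUK WZ) Rintegral_setU //; last 2 first.
- by rewrite setDUK.
- by apply/disj_setPRL; rewrite setDE => x [].
have h1 : Rintegral mu W (fun xi => expR (- (1 * symb xi))) <= expR (- d) * fine (mu W).
  rewrite -(Rintegral_cst mu mW); apply: le_Rintegral => //; try exact: iS.
    by apply: iS => //; exact: integrable_cst_Z.
  by move=> x Wx; rewrite ler_expR mul1r lerN2 hd.
have h2 : Rintegral mu (Z `\` W : set T) (fun xi => expR (- (1 * symb xi))) <=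
    1 * fine (mu (Z `\` W : set T)).
  rewrite -(Rintegral_cst mu mD); apply: le_Rintegral => //; try exact: iS.
    by apply: iS => //; exact: integrable_cst_Z.
  by move=> x Wx; exact: expR_symb_le1.
apply: le_lt_trans (lerD h1 h2) _; rewrite muD mul1r.
have w0 : 0 < fine (mu W) by rewrite fine_gt0 // W0 (le_lt_trans W1) ?ltry.
have e1 : expR (- d) < 1 by rewrite expR_lt1 oppr_lt0.
have : expR (- d) * fine (mu W) < 1 * fine (mu W) by rewrite ltr_pM2r.
lra.
Qed.

Lemma u_solE (x : T) (t : R) : Z x -> complex.Re (u_sol mu J x t) = return_prob t.
Proof.
rewrite {1}(Zpn_cyl R hp) => hx.
change (Rintegral mu Z (fun xi : T => complex.Re
  (chi_p R (oppQp (dotQpn x xi)) * cexp ((Jhat mu J xi - 1) * t%:C))%C) = return_prob t).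
apply: eq_Rintegral => xi; rewrite inE (Zpn_cyl R hp) => hxi.
rewrite (JhatE hp mu_inv mu_Zpn J_int) /chi_p.
have -> : fracQp (oppQp (dotQpn x xi)) = 0.
  rewrite /fracQp (res_opp hp).
  have := @phase_eq0 p hp n 0 x xi hx; rewrite oppr0 => /(_ hxi).
  by rewrite /phase /fracQp => ->; rewrite oppr0 reduce0.
rewrite rmorph0 mulr0 cos0 sin0 /cexp /=.
have -> : (1 - symb xi - 1) * t - (0 - 0) * 0 = - (t * symb xi) by ring.
have -> : (1 - symb xi - 1) * 0 + (0 - 0) * t = 0 :> R by ring.
by rewrite cos0 sin0; ring.
Qed.

(** Z_p^n is a group, so x - y stays in it for y in Z_p^n. The convolution then integrates the
    constant of [u_solE] over a set of measure 1. *)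
Lemma q_transE (x : T) (t : R) : 0 < t -> Z x -> complex.Re (q_trans mu J t x Z) = return_prob t.
Proof.
move=> t0 Zx; have mZ := @measurable_Zpn R p hp n.
rewrite /q_trans t0.
change (Rintegral mu setT (fun y : T => complex.Re
  (u_sol mu J (addQpn x (oppQpn y)) t * (\1_Z y : R)%:C)%C) = return_prob t).
rewrite (@eq_Rintegral _ _ _ _ _
  (fun y : T => ((fun=> return_prob t) \_ (Z : set T)) y)); last first.
  move=> y _; rewrite patchE; case: ifPn => [|/negP]; rewrite inE => Zy; last first.
    have -> : \1_Z y = 0 :> R by rewrite indicE memNset.
    by case: u_sol => u1 u2 /=; rewrite !mulr0 subr0.
  have -> : \1_Z y = 1 :> R by rewrite indicE mem_set.
  rewrite -(@u_solE (addQpn x (oppQpn y))); last first.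
    move: Zx Zy; rewrite (Zpn_cyl R hp) => hx hy.
    by apply/(cyl_sub hp); apply: cyl_trans (cyl_sym hy) hx.
  by case: u_sol => u1 u2 /=; ring.
by rewrite -Rintegral_mkcond (Rintegral_cst mu mZ) mu_Zpn mulr1.
Qed.

Lemma return_prob0 : return_prob 0 = 1.
Proof.
have mZ := @measurable_Zpn R p hp n.
rewrite /return_prob; under eq_Rintegral do rewrite mul0r oppr0 expR0.
by rewrite (Rintegral_cst mu mZ) mu_Zpn mulr1.
Qed.

(* With N = p^(k(n+1)) every term with m < N is at least p^(-kn) e^(-2K), so
   the sum of the first N terms is at least p^k e^(-2K). *)
Lemma return_prob_sum_unbounded (M : R) : exists N, M <= \sum_(m < N) return_prob m%:R.
Proof.
(* As k < p^k, this choice gives p^k e^(-2K) >= M. *)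
have [k hk] : exists k, M * expR (K + K) < k%:R.
  exists (Num.bound `|M * expR (K + K)|).
  exact: le_lt_trans (ler_norm _) (archi_boundP (normr_ge0 _)).
have p0 : (0 : R) < p%:R := pR_gt0 R hp.
exists ((p ^ n.+1) ^ k)%N.
have term (m : 'I_((p ^ n.+1) ^ k)) : (p ^ n)%:R ^- k * expR (- (K + K)) <= return_prob m%:R.
  apply: le_trans (return_prob_ge k (ler0n R m)); apply: ler_wpM2l.
    by rewrite invr_ge0 exprn_ge0.
  rewrite ler_expR lerN2; apply: (@le_trans _ _ (m%:R * (2 * (K / (p%:R ^+ n.+1) ^+ k)))).
    by apply: ler_wpM2l => //; apply: ler_wpM2l.
  rewrite -!natrX; set D : R := ((p ^ n.+1) ^ k)%:R.
  have D0 : 0 < D by rewrite ltr0n !expn_gt0 prime_gt0.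
  have -> : m%:R * (2 * (K / D)) = (K + K) * (m%:R / D) by ring.
  rewrite -[leRHS]mulr1 ler_wpM2l ?addr_ge0 ?(ltW K_gt0) //.
  by rewrite ler_pdivrMr // mul1r ler_nat ltnW.
apply: (@le_trans _ _ (\sum_(m < (p ^ n.+1) ^ k) (p ^ n)%:R ^- k * expR (- (K + K)))).
  rewrite sumr_const card_ord -[leRHS]mulr_natl mulrA.
  have -> : ((p ^ n.+1) ^ k)%:R * (p ^ n)%:R ^- k = (p ^ k)%:R :> R.
    rewrite expnS expnMn natrM natrX [X in _ * X / _]natrX mulfK //.
    by rewrite expf_neq0 // pnatr_eq0 -lt0n expn_gt0 prime_gt0.
  rewrite expRN ler_pdivlMr ?expR_gt0 //; apply: le_trans (ltW hk) _.
  by rewrite ler_nat ltnW // ltn_expl // prime_gt1.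
by apply: ler_sum => m _; exact: term.
Qed.

End ReturnProbability.

(** * Lower bound for the symbol near e_1 *)

Section SymbolLowerBound.
Variables (R : realType) (p : nat) (hp : prime p) (n : nat).
Local Notation T := (QpnB R p n.+1).
Variable mu : {measure set T -> \bar R}.
Hypothesis mu_inv : forall (a : T) (E : set T), measurable E ->
     mu [set addQpn a y | y in E] = mu E.
Hypothesis mu_Zpn : mu (Zpn R p n.+1) = 1%E.
Variable J : R -> R.
Hypothesis J_ge0 : forall r, 0 < r -> 0 <= J r.
Hypothesis J_int : (\int[mu]_(x in setT) (J (normQpn R x))%:E = 1)%E.
Hypothesis J_gt0 : forall x : T, normQpn R x != 0 -> 0 < J (normQpn R x).
Local Notation zero := (zeroQpn p n.+1).

Let e1 : Qpn p n.+1 := baseQpn p 1.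
Let e1p : Qpn p n.+1 := baseQpn p (p%:R)^-1.

(** Lying outside Z_p^n makes the norm, hence J, constant on [cyl 0 e1p]. *)
Lemma e1p_notin : ~ cyl 0 zero e1p.
Proof.
move=> /(_ ord0); rewrite (res_baseQpn hp _ _ (cong_invp p)) eqxx.
have p1 : (1 : rat) < p%:R by rewrite ltr1n prime_gt1.
rewrite /padic_reduce expr0z divr1 mul1r.
have -> : Num.floor ((p%:R : rat)^-1) = 0.
  apply: floor_def; rewrite add0r invr_ge0 (ltW (lt_trans ltr01 p1)) /=.
  by rewrite invf_lt1 // (lt_trans ltr01 p1).
by rewrite subr0 => /eqP; rewrite invr_eq0 gt_eqF // (lt_trans ltr01 p1).
Qed.

(** On [cyl 0 e1p], of measure 1, the phase is 1/p modulo 1 and the norm is constant. The integrand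
    thus equals d there, and it is nonnegative elsewhere. *)
Lemma symb_base_ge : exists2 d : R, 0 < d & forall xi, cyl 1 e1 xi -> d <= symb mu J xi.
Proof.
have n0 : normQpn R e1p != 0.
  by apply/lt0r_neq0; apply: (normQpn_gt0 R hp) => h; apply: e1p_notin; rewrite h.
exists ((1 - cos (2 * pi / p%:R)) * J (normQpn R e1p)).
  by rewrite mulr_gt0 ?J_gt0 // subr_gt0 (cos_2pi_div_lt1 R hp).
move=> xi hxi; set d := _ * _.
have isymb := integrable_symb hp J_int xi.
have fin : (\int[mu]_x ((1 - cphase R xi x) * Jnorm J x)%:E)%E \is a fin_num.
  exact: integrable_fin_num isymb.
have mV := measurable_cyl (R := R) hp 0 e1p.
rewrite -lee_fin /symb /Rintegral fineK // -[leLHS]mule1.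
rewrite -(mu_cyl0 hp mu_Zpn) -(mu_cyl hp mu_inv 0 e1p) -(integral_cst mu mV).
rewrite (@eq_integral _ _ _ mu _ (fun x => ((1 - cphase R xi x) * Jnorm J x)%:E)); last first.
  move=> x; rewrite inE => hx; rewrite (cphase_base R hp hxi hx) /Jnorm.
  by rewrite (normQpn_cyl R hp e1p_notin hx).
apply: ge0_subset_integral => //.
  by have /integrableP[] := isymb.
by move=> x _; rewrite lee_fin (symb_integrand_ge0 hp J_ge0).
Qed.

Lemma base_cyl_Zpn : cyl 1 e1 `<=` Zpn R p n.+1.
Proof.
rewrite (Zpn_cyl R hp) => x hx; apply: cyl_trans (cyl_le hp (_ : 0 <= 1) hx) => // i.
by rewrite (res_baseQpn hp _ _ (cong_one p)) (reduce_eq hp (cong_one p)) reduce0 if_same.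
Qed.

Lemma mu_base_cyl : (0 < mu (cyl 1 e1))%E.
Proof.
rewrite (mu_cyl hp mu_inv); apply: lt_le_trans (mu_ball_ge hp mu_inv mu_Zpn 1).
by rewrite lte_fin invr_gt0 expr1 ltr0n expn_gt0 prime_gt0.
Qed.

End SymbolLowerBound.

(** The vector e_1 needs a coordinate to live in, hence the passage from 0 < n to a successor. *)
Lemma return_prob1_lt1 (R : realType) (p : nat) (hp : prime p) (n : nat)
    (mu : {measure set (QpnB R p n) -> \bar R})
    (mu_inv : forall (a : QpnB R p n) (E : set (QpnB R p n)), measurable E ->
       mu [set addQpn a y | y in E] = mu E)
    (mu_Zpn : mu (Zpn R p n) = 1%E) (J : R -> R)
    (J_ge0 : forall r, 0 < r -> 0 <= J r)
    (J_int : (\int[mu]_(x in setT) (J (normQpn R x))%:E = 1)%E)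
    (J_gt0 : forall x : QpnB R p n, normQpn R x != 0 -> 0 < J (normQpn R x))
    (K : R) (K_gt0 : 0 < K)
    (tail_le : forall k : nat, Jtail mu J k <= K / ((p%:R : R) ^+ n.+1) ^+ k) :
  (0 < n)%N -> return_prob mu J 1 < 1.
Proof.
destruct n as [|n] => // _.
have [d d0 hd] := symb_base_ge hp mu_inv mu_Zpn J_ge0 J_int J_gt0.
apply: (return_prob1_lt1_of_ge hp mu_Zpn J_ge0 J_int K_gt0 tail_le _ (@base_cyl_Zpn R p hp n) _ d0 hd).
  exact: (measurable_cyl hp).
exact: (mu_base_cyl hp mu_inv mu_Zpn).
Qed.

(** * Renewal argument *)

(** After a first return at index j the weights restart from [r 0]; the bound obtained is the same
    for all j. *)
Lemma shifted_sum_le (R : realType) (r : nat -> R) (j N : nat) :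
    (forall k, 0 <= r k) ->
  \sum_(k < N | (j <= k)%N) r (k - j)%N <= \sum_(k < N.+1) r k.
Proof.
move=> r_ge0; have -> : \sum_(k < N | (j <= k)%N) r (k - j)%N = \sum_(k < N - j) r k.
  elim: N => [|N IH]; first by rewrite !big_ord0.
  rewrite big_mkcond big_ord_recr /= -big_mkcond /= IH; case: leqP => jN.
    by rewrite subSn // big_ord_recr.
  have /eqP -> : (N.+1 - j == 0)%N by rewrite subn_eq0.
  by have /eqP -> : (N - j == 0)%N; rewrite ?subn_eq0 1?ltnW // !big_ord0 addr0.
have -> : N.+1 = (N - j + (N.+1 - (N - j)))%N by lia.
by rewrite big_split_ord /= lerDl sumr_ge0.
Qed.

Section Renewal.
Context d (Omega : measurableType d) (R : realType) (P : probability Omega R).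
Variables (F : nat -> set (set Omega)) (V : nat -> set Omega) (r : nat -> R).
Hypothesis F_meas : forall s A, F s A -> measurable A.
Hypothesis F_setI : forall s A B, F s A -> F s B -> F s (A `&` B).
Hypothesis F_setC : forall s A, F s A -> F s (~` A).
Hypothesis F_le : forall s t A, (s <= t)%N -> F s A -> F t A.
Hypothesis F_V : forall s, F s (V s).
Hypothesis r_ge0 : forall k, 0 <= r k.
Hypothesis renewal : forall s k A, F s A -> A `<=` V s ->
  fine (P (A `&` V (s + k))) = fine (P A) * r k.
Hypothesis r_unbounded : forall M : R, exists N, M <= \sum_(k < N) r k.

Let mV s : measurable (V s). Proof. exact/F_meas/F_V. Qed.

Let prob (A : set Omega) : R := fine (P A).

Let prob_le A B : measurable A -> measurable B -> A `<=` B -> prob A <= prob B.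
Proof.
move=> mA mB AB; apply: fine_le; rewrite ?fin_num_measure //.
by apply: le_measure; rewrite ?inE.
Qed.

Let prob_bigcup N (A : nat -> set Omega) : (forall j, measurable (A j)) -> trivIset setT A ->
  prob (\big[setU/set0]_(j < N) A j) = \sum_(j < N) prob (A j).
Proof.
move=> mA tA; have mU : measurable (\big[setU/set0]_(j < N) A j) by exact: bigsetU_measurable.
apply: EFin_inj; rewrite -sumEFin /prob fineK ?fin_num_measure //.
rewrite measure_semi_additive //; apply: eq_bigr => i _.
by rewrite fineK ?fin_num_measure.
Qed.

Definition no_visit s N := \bigcap_(j in [set j | (0 < j <= N)%N]) ~` V (s + j).

(** The index j stands for the return at time s + j + 1. The event is known at that time, so the
    Markov property at this deterministic time restarts the count there. *)
Definition first_visit s (j : nat) := V s `&` (no_visit s j `&` V (s + j.+1)).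

Lemma F_no_visit s j N : (s + j <= N)%N -> F N (no_visit s j).
Proof.
elim: j => [|j IH] h.
  (* The whole space, written with the operations under which [F] is assumed closed. *)
  have -> : no_visit s 0 = ~` (V 0 `&` ~` V 0).
    apply/seteqP; split=> [w _ []//|w _ j /= /andP[]]; lia.
  by apply/F_setC/F_setI; [|apply/F_setC]; exact: F_le (F_V 0).
have -> : no_visit s j.+1 = no_visit s j `&` ~` V (s + j.+1).
  apply/seteqP; split=> [w hw|w [hw hj] i /= /andP[i0]].
    by split=> [i /= /andP[i0 ij]|]; apply: hw => /=; rewrite ?i0 ?ltnSn // leqW.
  rewrite leq_eqVlt => /predU1P[->//|ij]; apply: hw => /=; rewrite i0; exact: ij.
apply: F_setI; first by apply: IH; lia.
by apply: F_le (F_setC (F_V _)); lia.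
Qed.

Lemma F_first_visit s j : F (s + j.+1) (first_visit s j).
Proof.
apply: F_setI; first by apply: F_le (F_V s); lia.
apply: F_setI => //; apply: F_no_visit; lia.
Qed.

Let m_first_visit s j : measurable (first_visit s j).
Proof. exact: F_meas (F_first_visit s j). Qed.

Let m_no_visit s j : measurable (no_visit s j).
Proof. exact: F_meas (@F_no_visit s j _ (leqnn _)). Qed.

Lemma first_visit_disjoint s : trivIset setT (first_visit s).
Proof.
apply/trivIsetP => i j _ _; wlog ij : i j / (i < j)%N.
  move=> H; rewrite neq_ltn => /orP[ij|ji]; first by apply: H => //; rewrite ltn_eqF.
  by rewrite setIC; apply: H => //; rewrite ltn_eqF.
move=> _; apply/seteqP; split=> // w [[_ [_ hi]] [_ [hj _]]].
by apply: hj hi => /=; lia.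
Qed.

Lemma visit_split s k N : (k < N)%N ->
  V s `&` V (s + k.+1) = \big[setU/set0]_(j < N) (first_visit s j `&` V (s + k.+1)).
Proof.
move=> kN; rewrite -(bigcup_mkord N (fun j => first_visit s j `&` V (s + k.+1))).
apply/seteqP; split=> [w [ws wk]|w [j _ [[]]] //].
have : exists j, `[< V (s + j.+1) w >] by exists k; apply/asboolP.
move=> /ex_minnP[j /asboolP wj minj].
exists j; first by apply: leq_ltn_trans kN; apply: minj; apply/asboolP.
split => //; split => //; split => // i /= /andP[i0 ij] wi.
have := minj i.-1; rewrite prednK // => H.
have := H (introT (asboolP _) wi); lia.
Qed.

(* Summing over k < N the probabilities of V s & V (s + k.+1) and splitting
   each of them at the first visit after s gives
   P (V s) * (S_N.+1 - 1) <= P (V s, visit in [s+1, s+N]) * S_N.+1. *)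
Lemma visit_bound s N :
  prob (V s `&` no_visit s N) * (\sum_(k < N.+1) r k) <= prob (V s) * r 0%N.
Proof.
set S := \sum_(k < N.+1) r k.
pose hit := \big[setU/set0]_(j < N) first_visit s j.
have mhit : measurable hit by exact: bigsetU_measurable.
have hitE : prob (V s) = prob hit + prob (V s `&` no_visit s N).
  rewrite /prob -fineD ?fin_num_measure //; last exact: measurableI.
  rewrite -measureU //; first last.
  - apply/seteqP; split=> // w []; rewrite /hit -bigcup_mkord => -[j /= jN [_ [_ wj]]] [_ hw].
    by apply: hw wj => /=; lia.
  - exact: measurableI.
  congr (fine (P _)); apply/seteqP; split=> [w ws|w [|[]//]]; last first.
    by rewrite /hit -bigcup_mkord => -[j _ []].
  have [wn|/existsNP[j /not_implyP[/= /andP[j0 jN] /contrapT wj]]] := pselect (no_visit s N w).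
    by right.
  left; have : (V s `&` V (s + j.-1.+1)) w by rewrite prednK.
  rewrite (@visit_split s j.-1 N) ?prednK // /hit.
  rewrite -(bigcup_mkord N (first_visit s)).
  rewrite -(bigcup_mkord N (fun i => first_visit s i `&` V (s + j))) => -[i iN [wi _]].
  by exists i.
have sumE : \sum_(k < N) prob (V s `&` V (s + k.+1)) = prob (V s) * (S - r 0%N).
  rewrite /S big_ord_recl /= [X in _ * (X - _)]addrC addrK mulr_sumr; apply: eq_bigr => k _.
  by rewrite /prob renewal.
have sum_le : \sum_(k < N) prob (V s `&` V (s + k.+1)) <= prob hit * S.
  under eq_bigr => k _.
    rewrite (visit_split s (ltn_ord k)).
    rewrite (prob_bigcup N (A := fun j => first_visit s j `&` V (s + k.+1))); [over| |].
    - by move=> j; exact: measurableI.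
    - by apply: trivIset_setIr; exact: first_visit_disjoint.
  rewrite exchange_big /= /hit prob_bigcup //; last exact: first_visit_disjoint.
  rewrite mulr_suml; apply: ler_sum => j _.
  (* For k < j the visit would precede the first one; for k >= j, time s + k + 1 comes k - j steps
     after it. *)
  have -> : \sum_(k < N) prob (first_visit s j `&` V (s + k.+1)) =
      \sum_(k < N | (j <= k)%N) prob (first_visit s j) * r (k - j)%N.
    rewrite [RHS]big_mkcond; apply: eq_bigr => k _; case: leqP => jk.
      rewrite -(renewal _ (F_first_visit s j)) => [|w [_ []]//].
      by rewrite /prob -addnA addSn subnKC.
    rewrite (_ : _ `&` _ = set0) ?/prob ?measure0 //.
    by apply/seteqP; split=> // w [[_ [hj _]] hk]; apply: hj hk => /=; lia.
  rewrite -mulr_sumr; apply: ler_wpM2l; first exact: fine_ge0.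
  exact: shifted_sum_le.
(* With S the sum of the weights, (a + b)(S - r_0) <= a S rearranges to b S <= (a + b) r_0. *)
move: sum_le; rewrite sumE hitE; set a := prob hit; set b := prob _ => h; lra.
Qed.

(** By [visit_bound] the probability b of no return satisfies b S_N <= P(V s) r_0 for every N, which
    unbounded sums S_N permit only for b = 0. *)
Lemma no_return_null s : P (V s `&` \bigcap_N no_visit s N) = 0%E.
Proof.
have mA : measurable (V s `&` \bigcap_N no_visit s N).
  by apply: measurableI => //; exact: bigcapT_measurable.
suff : prob (V s `&` \bigcap_N no_visit s N) = 0.
  by rewrite /prob => h; rewrite -[LHS]fineK ?fin_num_measure // h.
apply/eqP; rewrite eq_le fine_ge0 // andbT leNgt; apply/negP => b0.
set b := prob _ in b0.
have [N hN] := r_unbounded ((prob (V s) * r 0%N + 1) / b).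
suff : b * (\sum_(k < N) r k) <= prob (V s) * r 0%N.
  by move: hN; rewrite ler_pdivrMr // mulrC; lra.
apply: le_trans (visit_bound s N).
have S0 : 0 <= \sum_(k < N) r k by exact: sumr_ge0.
apply: ler_pM => //; first exact: ltW.
  apply: prob_le => //; first exact: measurableI.
  by move=> w [ws wN]; split=> //; exact: wN.
by rewrite big_ord_recr /= lerDl.
Qed.

Definition stay N := \bigcap_(k in [set k | (k <= N)%N]) V k.

Lemma F_stay N : F N (stay N).
Proof.
elim: N => [|N IH].
  have -> : stay 0 = V 0; last by [].
  apply/seteqP; split=> [w|w h k /=]; first by apply.
  by rewrite leqn0 => /eqP ->.
have -> : stay N.+1 = stay N `&` V N.+1.
  apply/seteqP; split=> [w h|w [h1 h2] k /=].
    by split=> [k /= kN|]; apply: h => //=; exact: leqW.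
  by rewrite leq_eqVlt => /predU1P[->//|]; exact: h1.
by apply: F_setI => //; apply: F_le IH.
Qed.

(** A path in [stay N] is in Z_p^n at time N, so by [renewal] each further unit of time costs a
    factor [r 1]. *)
Lemma prob_stay N : prob (stay N) <= r 1%N ^+ N.
Proof.
elim: N => [|N IH].
  by rewrite expr0 -lee_fin fineK ?fin_num_measure ?probability_le1 //; exact: F_meas (F_stay 0).
have -> : stay N.+1 = stay N `&` V (N + 1).
  apply/seteqP; split=> [w h|w [h1 h2] k /=].
    by split=> [k /= kN|]; apply: h => //=; rewrite ?addn1 //; exact: leqW.
  by rewrite leq_eqVlt => /predU1P[->|]; [move: h2; rewrite addn1|exact: h1].
rewrite /prob (renewal _ (F_stay N)) => [|w h]; last exact: (h N (leqnn N)).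
by rewrite exprSr; apply: ler_wpM2r.
Qed.

Lemma stay_null : r 1%N < 1 -> P (\bigcap_k V k) = 0%E.
Proof.
move=> r1; have mA : measurable (\bigcap_k V k) by exact: bigcapT_measurable.
suff : prob (\bigcap_k V k) = 0.
  by rewrite /prob => h; rewrite -[LHS]fineK ?fin_num_measure // h.
apply/eqP; rewrite eq_le fine_ge0 // andbT leNgt; apply/negP => b0.
have /cvgrPdist_lt/(_ _ b0)[k0 _ /(_ k0 (leqnn _)) /=] : r 1%N ^+ i @[i --> \oo] --> 0.
  by apply: cvg_expr; rewrite ger0_norm.
rewrite sub0r normrN ger0_norm ?exprn_ge0 // ltNge => /negP; apply.
apply: le_trans (prob_stay k0); apply: prob_le => //.
  exact: F_meas (F_stay k0).
by move=> w h k _; exact: h.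
Qed.

End Renewal.

(** * The natural filtration of the process *)

Section Filtration.
Context d (Omega : measurableType d) d' (T : measurableType d') (R : realType).
Variable X : R -> Omega -> T.

Lemma nat_filtrationI s A B :
  nat_filtration X s A -> nat_filtration X s B -> nat_filtration X s (A `&` B).
Proof. exact: (@measurableI _ (g_sigma_algebraType _)). Qed.

Lemma nat_filtrationC s A : nat_filtration X s A -> nat_filtration X s (~` A).
Proof. exact: (@measurableC _ (g_sigma_algebraType _)). Qed.

Lemma nat_filtration_le s t A : s <= t -> nat_filtration X s A -> nat_filtration X t A.
Proof.
move=> st; apply: smallest_sub; first exact: smallest_sigma_algebra.
move=> _ [r [/andP[r0 rs] [B [mB ->]]]]; apply: sub_sigma_algebra.
by exists r; rewrite r0 (le_trans rs st); split=> //; exists B.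
Qed.

Lemma nat_filtration_preimage s B : 0 <= s -> measurable B ->
  nat_filtration X s (X s @^-1` B).
Proof.
by move=> s0 mB; apply: sub_sigma_algebra; exists s; rewrite s0 lexx; split=> //; exists B.
Qed.

Lemma nat_filtration_measurable s A : (forall t, 0 <= t -> measurable_fun setT (X t)) ->
  nat_filtration X s A -> measurable A.
Proof.
move=> mX; apply: smallest_sub; first exact: sigma_algebra_measurable.
move=> _ [r [/andP[r0 _] [B [mB ->]]]]; rewrite -[X in measurable X]setTI.
exact: mX.
Qed.

End Filtration.

Theorem theorem3
  (R : realType) (p : nat) (hp : prime p) (n : nat)
  (* Haar measure on Q_p^n, normalized by mu(Z_p^n) = 1 *)
  (mu : {measure set (QpnB R p n) -> \bar R})
  (mu_inv : forall (a : QpnB R p n) (E : set (QpnB R p n)), measurable E ->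
     mu [set addQpn a y | y in E] = mu E)
  (mu_Zpn : mu (Zpn R p n) = 1%E)
  (* the kernel J : R_+ -> R_+ *)
  (J : R -> R)
  (J_cont : {within [set r : R | 0 < r], continuous J})
  (J_ge0 : forall r, 0 < r -> 0 <= J r)
  (J_int : (\int[mu]_(x in setT) (J (normQpn R x))%:E = 1)%E)
  (* J(||x||_p) is of exponential type with exponent gamma, -n < gamma < 0 *)
  (gamma : R) (gamma_gt : - (n%:R) < gamma) (gamma_lt0 : gamma < 0)
  (J_exp : exists A B C1 : R, [/\ 0 < A, 0 < B, 0 < C1 &
     forall x : QpnB R p n, normQpn R x != 0 ->
       A * (normQpn R x `^ gamma) * expR (- C1 * normQpn R x) <= J (normQpn R x) /\
       J (normQpn R x) <= B * (normQpn R x `^ gamma) * expR (- C1 * normQpn R x)])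
  (* the Markov process on the probability space (Upsilon, F, P) *)
  (dU : measure_display) (Upsilon : measurableType dU)
  (P : probability Upsilon R)
  (X : R -> Upsilon -> QpnB R p n)
  (X_markov : is_markov_process P X (q_trans mu J))
  (X_init : P (X 0 @^-1` Zpn R p n) = 1%E) :
  {ae P, forall w, (first_passage_time X (Zpn R p n) w < +oo)%E}.
Proof.
have [A [B [C1 [A_gt0 B_gt0 C1_gt0 J_AB]]]] := J_exp.
have [K K_gt0 tail_le] := Jtail_le hp mu_inv mu_Zpn J_ge0 (ltW gamma_lt0) B_gt0 C1_gt0
  (fun x nx => (J_AB x nx).2).
have [mX markov] := X_markov.
have mZ := @measurable_Zpn R p hp n.
pose Z : set (QpnB R p n) := Zpn R p n.
pose V (k : nat) := X k%:R @^-1` Z.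
pose F (k : nat) := nat_filtration X (k%:R : R).
pose r (k : nat) := return_prob mu J k%:R.
have F_meas s E : F s E -> measurable E := @nat_filtration_measurable _ _ _ _ _ X _ _ mX.
have F_setI s E E' : F s E -> F s E' -> F s (E `&` E') := @nat_filtrationI _ _ _ _ _ X _ E E'.
have F_setC s E : F s E -> F s (~` E) := @nat_filtrationC _ _ _ _ _ X _ E.
have F_le s t E : (s <= t)%N -> F s E -> F t E.
  by move=> st; apply: nat_filtration_le; rewrite ler_nat.
have F_V s : F s (V s) by exact: nat_filtration_preimage.
have r_ge0 k : 0 <= r k by exact: return_prob_ge0.
have renewal s k E : F s E -> E `<=` V s ->
    fine (P (E `&` V (s + k)%N)) = fine (P E) * r k.
  (* Lag 0 is separate: [q_trans] at time 0 is an indicator, and [q_transE] concerns positive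
     times. *)
  move=> FE EV; case: k => [|k].
    by rewrite addn0 /r (return_prob0 hp mu_Zpn) mulr1 (setIidl EV).
  have := markov s%:R (s + k.+1)%N%:R (ler0n _ _) _ Z mZ E FE.
  rewrite ler_nat leq_addr => /(_ isT) /(congr1 (@complex.Re R)) /= ->.
  rewrite /cintegral /= natrD addrAC subrr add0r.
  rewrite (@eq_Rintegral _ _ _ _ _ (fun=> r k.+1)); last first.
    move=> w; rewrite inE => Ew.
    by apply: (q_transE hp mu_inv mu_Zpn J_int) => //; exact: EV.
  rewrite (Rintegral_cst P (F_meas _ _ FE)); exact: mulrC.
have r_unbounded M : exists N, M <= \sum_(k < N) r k.
  exact: (return_prob_sum_unbounded hp mu_inv mu_Zpn J_ge0 J_int K_gt0 tail_le).
have r1 : r 1%N < 1.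
  apply: (return_prob1_lt1 hp mu_inv mu_Zpn J_ge0 J_int _ K_gt0 tail_le) => [x nx|].
    apply: lt_le_trans (J_AB x nx).1; rewrite mulr_gt0 ?expR_gt0 // mulr_gt0 //.
    by rewrite powR_gt0 // lt_def nx; exact: normQpn_ge0.
  (* The inequalities -n < gamma < 0 exclude n = 0. *)
  by rewrite lt0n -(pnatr_eq0 R); apply: contraTneq gamma_gt => ->; rewrite oppr0 -leNgt ltW.
have null E : measurable E -> P E = 0%E -> P.-negligible E.
  by move=> mE; move/negligibleP: mE => ->.
have V0 : P.-negligible (~` V 0%N).
  apply: null; first by apply: measurableC; exact: F_meas (F_V 0%N).
  rewrite probability_setC ?X_init ?subee //; exact: F_meas (F_V 0%N).
have exits : P.-negligible (\bigcap_k V k).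
  apply: null; last exact: (stay_null F_meas F_setI F_le F_V r_ge0 renewal r1).
  by apply: bigcapT_measurable => k; exact: F_meas (F_V k).
have returns : P.-negligible (\bigcup_s (V s `&` \bigcap_N no_visit V s N)).
  apply: negligible_bigcup => s; apply: null; last first.
    exact: (no_return_null F_meas F_setI F_setC F_le F_V r_ge0 renewal r_unbounded).
  apply: measurableI; first exact: F_meas (F_V s).
  apply: bigcapT_measurable => N.
  exact: F_meas (F_no_visit F_setI F_setC F_le F_V (leqnn _)).
(* Off three null sets, the path starts in Z_p^n, is outside it at some integer time k, and returns
   after each integer visit. *)
apply: negligibleS (negligibleU V0 (negligibleU exits returns)) => w.
apply: contra_notP => /not_orP[/contrapT w0 /not_orP[/existsNP[k /not_implyP[_ wk]] wr]].
have k0 : (0 < k)%N by case: k wk.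
(* Then m is one of the times over which the infimum is taken, with t' = k. *)
suff [m km wm] : exists2 m, (k < m)%N & V m w.
  apply: le_lt_trans (ltry (m%:R : R)); apply: ereal_inf_lbound; exists m%:R => //.
  split; first by rewrite ltr0n (leq_trans _ km).
  by split => //; exists k%:R; rewrite ltr0n ltr_nat k0 km.
apply: contrapT => hm.
(* Let s be the last integer visit up to k; time 0 shows that there is one. Without a visit after k
   the path never returns after s, against [wr]. *)
have ex : exists s, (s <= k)%N && `[< V s w >].
  by exists 0%N; apply/asboolP.
have ub s : (s <= k)%N && `[< V s w >] -> (s <= k)%N by case/andP.
case: (ex_maxnP ex ub) => s /andP[sk /asboolP ws] smax.
apply: wr; exists s => //; split=> // N _ j /= /andP[j0 _] wj.
have : (s + j <= k)%N by rewrite leqNgt; apply/negP => kj; apply: hm; exists (s + j)%N.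
move=> sjk; have := smax (s + j)%N; rewrite sjk (introT (asboolP _) wj) => /(_ isT); lia.
Qed.
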